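(* Let $\mu>0$ and consider the boundary $b(t)=\mu t$. Suppose $\tau_{X,\mu}$ has density $f\in\mathcal C$, say $$f(t)=\sum_{n=1}^\infty p_nf_{a_n,b_n}(t),\qquad p_n\ge0,\quad \sum_{n=1}^\infty p_n=1,\quad b_n>0,\quad \inf_{n\ge1}a_n\ge 2/\mu^2 .$$ Then the matching density $g$ (the density of $X$) is given by $$g(x)=\sum_{n=1}^\infty p_n\,\frac{\sqrt{2\pi}\,e^{-\mu x}}{\Gamma(b_n)\sqrt{a_n}}\left(\frac{x}{a_n\sqrt{\mu^2-2/a_n}}\right)^{b_n-1/2}I_{b_n-1/2}\!\left(x\sqrt{\mu^2-2/a_n}\right),\qquad x>0 .$$
   Context: $W_t$ is a standard Brownian motion started at $0$, $X\ge0$ is a random variable independent of $W$, and $\tau_{X,\mu}=\inf\{t>0: W_t+X\le\mu t\}$. For $a,b>0$, $f_{a,b}(t)=\frac{t^{b-1}e^{-t/a}}{\Gamma(b)a^b}$, $t>0$, is the Gamma density with scale $a$ and shape $b$. $\mathcal C$ is the class of densities of the form $f(t)=\sum_{n=1}^\infty p_nf_{a_n,b_n}(t)$ with $p_n\ge0$, $\sum_{n=1}^\infty p_n=1$, $b_n>0$ for all $n$, and $\inf_{n\ge1}a_n\ge2/\mu^2$. $I_\nu$ is the modified Bessel function of the first kind. The matching density for a boundary and a target density $f$ is the density $g$ on $(0,\infty)$ of a random variable $X$ for which the first passage time has density $f$. For indices with $a_n=2/\mu^2$ the corresponding term is understood as its limit as $\sqrt{\mu^2-2/a_n}\downarrow0$.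 *)

(* Defs.v *)
From HB Require Import structures.
From mathcomp Require Import all_boot all_order all_algebra.
From mathcomp Require Import all_classical all_reals all_analysis.
From mathcomp Require Import measurable_realfun.

Set Implicit Arguments.
Unset Strict Implicit.
Unset Printing Implicit Defensive.

Import Order.TTheory GRing.Theory Num.Theory.
Import numFieldNormedType.Exports.

Local Open Scope classical_set_scope.
Local Open Scope ring_scope.

Section special_functions.
Context {R : realType}.
Implicit Types (s nu z a b t : R).

(* The integral converges only for s > 0, the only case used below. *)
Definition Gamma s : R :=
  \int[lebesgue_measure]_(t in `]0, +oo[) (t `^ (s - 1) * expR (- t)).

(* I_nu(z) for nu > -1 and z > 0: all the arguments of Gamma are positive. *)
Definition besselI nu z : R :=
  limn (series (fun k : nat =>
    (z / 2) `^ (2 * k%:R + nu) / (k`!%:R * Gamma (k%:R + nu + 1)))).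

Definition gamma_pdf a b t : R :=
  t `^ (b - 1) * expR (- t / a) / (Gamma b * a `^ b).

(* The n-th term of the matching density, without its weight p_n, with c
   being sqrt (mu ^ 2 - 2 / a). *)
Definition matching_term_at mu a b c x : R :=
  Num.sqrt (2 * pi) * expR (- mu * x) / (Gamma b * Num.sqrt a)
  * (x / (a * c)) `^ (b - 1 / 2) * besselI (b - 1 / 2) (x * c).

(* For a = 2 / mu ^ 2, c = 0 and x / (a * c) is meaningless, hence the limit as
   c decreases to 0. *)
Definition matching_term mu a b x : R :=
  if a == 2 / mu ^+ 2 then lim (matching_term_at mu a b c x @[c --> 0^'+])
  else matching_term_at mu a b (Num.sqrt (mu ^+ 2 - 2 / a)) x.

(* f belongs to the class of gamma mixtures, with weights p, scales a and
   shapes b; sequences are indexed from 0. *)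
Definition gamma_mixture mu (p a b : nat -> R) (f : R -> R) : Prop :=
  [/\ forall n, 0 <= p n,
      series p @ \oo --> (1 : R),
      forall n, 0 < b n,
      2 / mu ^+ 2 <= inf (range a) &
      forall t, 0 < t ->
        series (fun n => p n * gamma_pdf (a n) (b n) t) @ \oo --> f t].

End special_functions.

Section processes.
Context {d : measure_display} {T : measurableType d} {R : realType}.
Variable P : probability T R.
Implicit Types (W : R -> {RV P >-> R}) (X : {RV P >-> R}).

(* Only the times t >= 0 matter. *)
Definition brownian_motion W : Prop :=
  [/\ {ae P, forall w, W 0 w = 0},
      (forall (t : nat -> R) (A : nat -> set R) (n : nat),
         0 <= t 0%N -> nondecreasing_seq t -> (forall i, measurable (A i)) ->
         P (\bigcap_(i < n) ((W (t i.+1) \- W (t i)) @^-1` A i)) =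
         (\prod_(i < n) P ((W (t i.+1) \- W (t i))%R @^-1` A i))%E),
      (* the second parameter of normal_prob is the standard deviation *)
      (forall s t (A : set R), 0 <= s -> s < t -> measurable A ->
         P ((W t \- W s) @^-1` A) = normal_prob 0 (Num.sqrt (t - s)) A) &
      {ae P, forall w, {within `[0, +oo[, continuous (fun t => W t w)}}].

Definition independent_of_process X W : Prop :=
  forall (A : set R) (E : set T), measurable A ->
    <<s [set F | exists t (B : set R),
           [/\ 0 <= t, measurable B & F = W t @^-1` B]] >> E ->
    P (X @^-1` A `&` E) = (P (X @^-1` A) * P E)%E.

(* Equals +oo when the boundary is never reached. *)
Definition first_passage_time W X (bd : R -> R) (w : T) : \bar R :=
  ereal_inf [set t%:E | t in [set t | 0 < t /\ W t w + X w <= bd t]].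

(* Y is a random variable with density f on ]0, +oo[; the values of f outside
   ]0, +oo[ are irrelevant. *)
Definition has_density (Y : T -> \bar R) (f : R -> R) : Prop :=
  [/\ measurable_fun setT Y,
      measurable_fun (`]0, +oo[%classic : set R) f,
      (forall t, 0 < t -> 0 <= f t),
      (\int[lebesgue_measure]_(t in `]0%R, +oo[) (f t)%:E = 1)%E &
      forall A : set R, measurable A ->
        P (Y @^-1` (EFin @` A)) =
        (\int[lebesgue_measure]_(t in A `&` `]0%R, +oo[) (f t)%:E)%E].

End processes.

Arguments brownian_motion {d T R} P W.
Arguments independent_of_process {d T R} P X W.

(* Main.v *)
Require Import Defs.
From HB Require Import structures.
From mathcomp Require Import all_boot all_order all_algebra.
From mathcomp Require Import all_classical all_reals all_analysis.
From mathcomp Require Import measurable_realfun.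
From mathcomp Require Import ring lra.

Set Implicit Arguments.
Unset Strict Implicit.
Unset Printing Implicit Defensive.

Import Order.TTheory GRing.Theory Num.Theory.
Import numFieldNormedType.Exports.

Local Open Scope classical_set_scope.
Local Open Scope ring_scope.

(* Let Y_t = X + W_t - mu t and s = l mu + l^2 / 2 with l >= 0. Optional stopping of
   the martingale exp (- l Y_t - s t) at tau, where Y vanishes, gives
   E exp (- l X) = E exp (- s tau); it is done on the grids of step 1/n, and n tends to
   infinity. So it suffices that the transform of g at l is the transform of f at s,
   which is checked on one gamma density. Writing s + 1 / a as
   (l + mu)^2 / 2 - (mu^2 / 2 - 1 / a) and expanding in powers of
   mu^2 / 2 - 1 / a >= 0, on the side of g through the power series of the Bessel
   function, the transforms agree term by term by the duplication formula
   of the Gamma function. Finally the law of X >= 0 is determined by its Laplace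
   transform at the integers: (1 - exp (- n x))^m, with m of the order of n exp (n y),
   tends to the indicator of x > y. *)

(** * The Gamma function *)

(** On a grid, optional stopping is a finite induction that uses only the independence of finitely
    many increments. The price is that the stopped path is no longer exactly at 0, so the identity
    at tau is recovered as two inequalities. Stopping at a level eps > 0 yields Y <= eps, hence the
    bound of E exp (- l X) from below; thanks to the positive level, continuity of the path is
    enough and no crossing property of Brownian motion is used. Stopping at level 0 yields the bound
    from above: the path cannot stop before tau, but it may overshoot below 0, where exp (- l Y) is
    unbounded, and uniform integrability has to be supplied. The condition a_n >= 2 / mu^2 makes all
    coefficients of the power expansions nonnegative, so every exchange of sum and integral is
    monotone convergence. That the series of g converges at every x > 0 is a separate matter: it is
    dominated by a multiple of the series of f at t = x^2 / 2. *)

Section substitution.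
Context {R : realType}.
Notation leb := (@lebesgue_measure R).
Local Open Scope ereal_scope.

(* No condition on the derivative at infinity, unlike
   increasing_ge0_integration_by_substitutionT. *)
Lemma ge0_integral_range (F F' G : R -> R) :
  (forall x : R, is_derive x (1%R : R) F (F' x)) -> continuous F' ->
  (forall x, 0 < F' x)%R ->
  {in range F, continuous G} -> {in range F, forall x, 0 <= G x}%R ->
  \int[leb]_(x in range F) (G x)%:E = \int[leb]_x (G (F x) * F' x)%:E.
Proof.
move=> dF cF' F'0 cG G0.
have drF x : derivable F x 1 by have [] := dF x.
have cF : continuous F.
  by move=> x; exact/differentiable_continuous/derivable1_diffP.
have F'E : (F^`())%classic = F'.
  by apply/funext => x; rewrite derive1E; exact: derive_val.
have incF : {homo F : x y / (x < y)%R}.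
  move=> x y xy.
  have [c _] := MVT xy (fun x _ => dF x) (continuous_subspaceT cF).
  by move=> e; rewrite -subr_gt0 e mulr_gt0 ?subr_gt0.
have lecF : {homo F : x y / (x <= y)%R} by exact: ltW_homo.
(* Both sides are exhausted by the compact intervals [E n] and their images [FE n], where
   substitution asks for nothing at infinity; monotone convergence does the rest. *)
pose E (n : nat) : set R := `[(- n%:R)%R, n%:R]%classic.
pose FE (n : nat) : set R := `[F (- n%:R)%R, F n%:R]%classic.
have FErange n : FE n `<=` range F.
  move=> y; rewrite /FE /= in_itv/= => /andP[y1 y2].
  have nn : (- n%:R <= n%:R :> R)%R by rewrite (@le_trans _ _ 0%R)// oppr_le0.
  have := @IVT _ F (- n%:R)%R n%:R y nn (continuous_subspaceT cF).
  rewrite min_l ?max_r ?lecF// y1 y2 => /(_ isT)[c _ <-]; by exists c.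
have UE : \bigcup_n E n = setT.
  apply/seteqP; split => // x _.
  exists (Num.truncn `|x|).+1 => //; rewrite /E/= in_itv/= -ler_norml.
  exact/ltW/truncnS_gt.
have UFE : \bigcup_n FE n = range F.
  apply/seteqP; split; first by move=> y [n _ /FErange].
  move=> _ [x _ <-]; have : (\bigcup_n E n) x by rewrite UE.
  move=> [n _]; rewrite /E/= in_itv/= => /andP[x1 x2].
  by exists n => //; rewrite /FE/= in_itv/= !lecF.
have ndE : nondecreasing_seq E.
  move=> n m nm; apply/subsetPset; apply: subset_itv; rewrite bnd_simp ?lerN2 ler_nat//.
have ndFE : nondecreasing_seq FE.
  move=> n m nm; apply/subsetPset.
  apply: subset_itv; rewrite bnd_simp lecF// ?lerN2 ler_nat//.
have cFEG n : {within FE n, continuous G}.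
  by apply: continuous_in_subspaceT => x /[!inE] /FErange xF; apply: cG; rewrite inE.
have cint : continuous (fun x => G (F x) * F' x)%R.
  move=> x; apply: continuousM; last exact: cF'.
  by apply: continuous_comp; [exact: cF|apply: cG; rewrite inE; exists x].
have mint : measurable_fun setT (fun x => (G (F x) * F' x)%:E).
  by apply/measurable_EFinP; exact: continuous_measurable_fun.
have h1 : \int[leb]_(x in FE n) (G x)%:E @[n --> \oo] -->
    \int[leb]_(x in \bigcup_n FE n) (G x)%:E.
  apply: ge0_nondecreasing_set_cvg_integral => //.
  - by move=> n; exact: measurable_itv.
  - by move=> n; apply/measurable_EFinP; apply: subspace_continuous_measurable_fun => //; exact: measurable_itv.
  - by move=> n x FEx; rewrite lee_fin G0// inE; exact: FErange FEx.
have h2 : \int[leb]_(x in E n) (G (F x) * F' x)%:E @[n --> \oo] -->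
    \int[leb]_(x in \bigcup_n E n) (G (F x) * F' x)%:E.
  apply: ge0_nondecreasing_set_cvg_integral => //.
  - by move=> n; exact: measurable_itv.
  - by move=> n; exact: measurable_funTS.
  - by move=> n x Ex; rewrite lee_fin mulr_ge0 ?(ltW (F'0 _))// G0// inE; exists x.
rewrite -UFE -UE; apply: (cvg_unique _ h1) => //.
apply: cvg_trans h2; apply: near_eq_cvg; near=> n; apply/esym.
rewrite /FE integration_by_substitution_increasing//.
- by rewrite F'E.
- by rewrite (@le_trans _ _ 0%R)// oppr_le0.
- by move=> x y _ _; exact: incF.
- by rewrite F'E => x _; exact: cF'.
- by rewrite F'E; apply/cvg_ex; eexists; apply: cvg_at_right_filter; exact: cF'.
- by rewrite F'E; apply/cvg_ex; eexists; apply: cvg_at_left_filter; exact: cF'.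
- split => [x _ //||].
  + by apply: cvg_at_right_filter; exact: cF.
  + by apply: cvg_at_left_filter; exact: cF.
- exact: cFEG.
Unshelve. all: by end_near. Qed.

Lemma range_expR : range (@expR R) = `]0%R, +oo[%classic.
Proof.
apply/seteqP; split => [_ [x _ <-]|x]; rewrite /= in_itv/= andbT ?expR_gt0//.
by move=> x0; exists (ln x) => //; exact: lnK.
Qed.

Lemma ge0_integral_expR (G : R -> R) :
  {in `]0%R, +oo[, continuous G} -> {in `]0%R, +oo[, forall x, 0 <= G x}%R ->
  \int[leb]_(x in `]0%R, +oo[) (G x)%:E = \int[leb]_x (G (expR x) * expR x)%:E.
Proof.
move=> cG G0; rewrite -range_expR (@ge0_integral_range expR expR)//.
- by move=> x; exact: continuous_expR.
- by move=> x; exact: expR_gt0.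
- by move=> x; rewrite range_expR inE; exact: cG.
- by move=> x; rewrite range_expR inE; exact: G0.
Qed.

Lemma ge0_integral_affine (G : R -> R) (c r : R) : (0 < r)%R ->
  continuous G -> (forall x, 0 <= G x)%R ->
  \int[leb]_x (G x)%:E = r%:E * \int[leb]_x (G (r * x + c))%:E.
Proof.
move=> r0 cG G0.
have rangeE : range (fun x : R => r * x + c)%R = setT.
  apply/seteqP; split => // y _; exists ((y - c) / r)%R => //.
  by rewrite mulrC divfK ?gt_eqF// subrK.
have dF (x : R) : is_derive x (1%R : R) (fun x : R => r * x + c)%R (cst r x).
  by apply: is_derive_eq; rewrite addr0 [LHS]mulr1.
rewrite -[in LHS]rangeE (ge0_integral_range dF)//.
- rewrite -ge0_integralZl//.
  + by apply: eq_integral => x _; rewrite -EFinM mulrC.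
  + apply/measurable_EFinP/measurableT_comp; first exact: continuous_measurable_fun.
    by apply: measurable_funD => //; exact: measurable_funM.
  + by move=> x _; rewrite lee_fin.
  + by rewrite lee_fin ltW.
- by move=> x; exact: cvg_cst.
Qed.

Lemma ge0_integral_oppr (f : R -> \bar R) :
  measurable_fun setT f -> (forall x, 0 <= f x) ->
  \int[leb]_x f (- x)%R = \int[leb]_x f x.
Proof.
move=> mf f0; rewrite -[X in integral _ X _](preimage_setT (-%R : _ -> measurableTypeR R)).
rewrite -ge0_integral_pushforward//=.
by apply: eq_measure_integral => //= A mA AS; exact: lebesgue_measureN.
Qed.

Lemma continuous_powR (r t : R) : (0 < t)%R -> {for t, continuous (fun x : R => x `^ r)%R}.
Proof.
move=> t0; apply/differentiable_continuous/derivable1_diffP.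
by apply: derivable_powR; rewrite in_itv/= andbT.
Qed.

End substitution.

Section gamma_function.
Context {R : realType}.
Notation leb := (@lebesgue_measure R).
Implicit Types s c b t : R.
Local Open Scope ereal_scope.

(* After t = exp u, the Gamma integral lives on the whole line. *)
Definition gammaT s u : R := expR (s * u - expR u).

Lemma continuous_gammaT s : continuous (gammaT s).
Proof.
move=> u; apply: continuous_comp; last exact: continuous_expR.
by apply: continuousB; [exact: mulrl_continuous|exact: continuous_expR].
Qed.

Lemma measurable_gammaT s : measurable_fun setT (gammaT s).
Proof. by apply: continuous_measurable_fun; exact: continuous_gammaT. Qed.

Lemma integral_gammaE s :
  \int[leb]_(t in `]0%R, +oo[) (t `^ (s - 1) * expR (- t))%:E =
  \int[leb]_u (gammaT s u)%:E.
Proof.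
rewrite (@ge0_integral_expR R (fun t => t `^ (s - 1) * expR (- t))%R).
- apply: eq_integral => u _; congr EFin.
  rewrite -expRM -!expRD; congr expR; lra.
- move=> t; rewrite in_itv/= andbT => t0; apply: cvgM; first exact: continuous_powR.
  by apply: continuous_comp; [exact: continuousN|exact: continuous_expR].
- by move=> t _; rewrite mulr_ge0 ?powR_ge0 ?expR_ge0.
Qed.

Lemma integral_gammaT_lt_pinfty s : (0 < s)%R ->
  \int[leb]_u (gammaT s u)%:E < +oo.
Proof.
(* For u >= 0, exp u >= 1 + u^2 / 2, and completing the square in (s + 1) u - u^2 / 2 gives [C]; for
   u < 0 the factor exp (s u) alone is integrable. Both bounds are multiples of exponential
   densities. *)
move=> s0; pose C := expR ((s + 1) ^+ 2 / 2).
pose h (u : R) := (C * exponential_pdf 1 u + s^-1 * exponential_pdf s (- u))%R.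
have mpdf r : measurable_fun setT (@exponential_pdf R r).
  exact: measurable_exponential_pdf.
have p0 r (u : R) : (0 < r)%R -> (0 <= exponential_pdf r u)%R.
  by move=> r0; apply: exponential_pdf_ge0; exact: ltW.
have mpdfN : measurable_fun setT (fun u : R => exponential_pdf s (- u)%R).
  by apply: measurableT_comp => //; exact: mpdf.
apply: (@le_lt_trans _ _ (\int[leb]_u (h u)%:E)).
  apply: ge0_le_integral => //.
  - by move=> u _; rewrite lee_fin expR_ge0.
  - by apply/measurable_EFinP; exact: measurable_gammaT.
  - apply/measurable_EFinP; apply: measurable_funD; (apply: measurable_funM => //). exact: mpdf.
  move=> u _; rewrite lee_fin /h /gammaT.
  have [u0|u0] := leP 0%R u.
    rewrite (@le_trans _ _ (C * exponential_pdf 1 u)%R) ?lerDl ?mulr_ge0 ?p0 ?invr_ge0 ?(ltW s0)//.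
    rewrite exponential_pdfE// mul1r mulN1r -expRD ler_expR.
    have := @expR_ge1Dxn R u 1 u0; rewrite (_ : 2`!%:R = 2%R)//.
    have : (0 <= (s + 1 - u) ^+ 2)%R by exact: sqr_ge0.
    nra.
  rewrite (@le_trans _ _ (s^-1 * exponential_pdf s (- u))%R) ?lerDr ?mulr_ge0 ?p0 ?expR_ge0//.
  rewrite exponential_pdfE ?oppr_ge0 ?(ltW u0)// mulrA mulVf ?gt_eqF// mul1r.
  by rewrite ler_expR mulrNN gerBl expR_ge0.
under eq_integral do rewrite EFinD !EFinM.
rewrite ge0_integralD//; first last.
- by apply/measurable_EFinP; apply: measurable_funM => //; exact: mpdfN.
- by move=> u _; rewrite lee_fin mulr_ge0 ?p0 ?invr_ge0 ?ltW.
- by apply/measurable_EFinP; apply: measurable_funM => //; exact: mpdf.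
- by move=> u _; rewrite lee_fin mulr_ge0 ?p0 ?expR_ge0.
rewrite !ge0_integralZl//; first last.
- by rewrite lee_fin expR_ge0.
- by move=> u _; rewrite lee_fin p0.
- by apply/measurable_EFinP; exact: mpdf.
- by rewrite lee_fin invr_ge0 ltW.
- by move=> u _; rewrite lee_fin p0.
- by apply/measurable_EFinP; exact: mpdfN.
rewrite integral_exponential_pdf// (ge0_integral_oppr (f := EFin \o exponential_pdf s))//.
- by rewrite integral_exponential_pdf// !mule1 -EFinD ltry.
- by apply/measurable_EFinP; exact: mpdf.
- by move=> u; rewrite lee_fin p0.
Qed.

Lemma Gamma_EFin s : (0 < s)%R -> (Gamma s)%:E = \int[leb]_u (gammaT s u)%:E.
Proof.
move=> s0; rewrite /Gamma /Rintegral integral_gammaE fineK//.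
rewrite ge0_fin_numE ?integral_gammaT_lt_pinfty//.
by apply: integral_ge0 => u _; rewrite lee_fin expR_ge0.
Qed.

(* The integral over u in [0, 1] is at least expR (- expR 1). *)
Lemma Gamma_ge s : (0 < s)%R -> (expR (- expR 1) <= Gamma s)%R.
Proof.
move=> s0; rewrite -lee_fin Gamma_EFin//.
rewrite -[leLHS]mule1 -[X in _ * X](_ : leb (`[0%R, 1%R]%classic) = 1).
  rewrite -integral_cst//; apply: le_trans.
    apply: (@ge0_le_integral _ _ _ leb `[0%R, 1%R]%classic _ _ (fun u => (gammaT s u)%:E)) => //.
    - by move=> u _; rewrite lee_fin expR_ge0.
    - by apply/measurable_EFinP/measurable_funTS; exact: measurable_gammaT.
    - move=> u /=; rewrite in_itv/= => /andP[u0 u1].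
      rewrite lee_fin ler_expR.
      have : (expR u <= expR 1)%R by rewrite ler_expR.
      have : (0 <= s * u)%R by rewrite mulr_ge0// ltW.
      lra.
  apply: ge0_subset_integral => //.
  - by apply/measurable_EFinP; exact: measurable_gammaT.
  - by move=> u _; rewrite lee_fin expR_ge0.
by rewrite lebesgue_measure_itv/= lte_fin ltr01 oppr0 adde0.
Qed.

Lemma Gamma_gt0 s : (0 < s)%R -> (0 < Gamma s)%R.
Proof. by move=> s0; rewrite (lt_le_trans _ (Gamma_ge s0))// expR_gt0. Qed.

Lemma integral_gamma_scale s c : (0 < s)%R -> (0 < c)%R ->
  \int[leb]_(t in `]0%R, +oo[) (t `^ (s - 1) * expR (- (c * t)))%:E =
  (Gamma s * c `^ (- s))%:E.
Proof.
move=> s0 c0.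
rewrite (@ge0_integral_expR R (fun t => t `^ (s - 1) * expR (- (c * t)))%R).
- rewrite mulrC EFinM Gamma_EFin// (ge0_integral_affine (ln c) ltr01)//.
  + rewrite mul1e -ge0_integralZl//; first last.
    * by rewrite lee_fin powR_ge0.
    * by move=> u _; rewrite lee_fin expR_ge0.
    * apply/measurable_EFinP; apply: measurableT_comp; first exact: measurable_gammaT.
      by apply: measurable_funD => //; exact: measurable_funM.
    apply: eq_integral => u _; rewrite -EFinM; congr EFin.
    have -> : (c `^ (- s) = expR (ln c * - s))%R by rewrite expRM lnK ?posrE.
    rewrite /gammaT mul1r [expR (u + _)]expRD lnK ?posrE// -expRM -!expRD.
    by congr expR; ring.
  + exact: continuous_gammaT.
  + by move=> u; exact: expR_ge0.
- move=> t; rewrite in_itv/= andbT => t0; apply: cvgM; first exact: continuous_powR.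
  apply: continuous_comp; last exact: continuous_expR.
  by apply: continuousN; exact: mulrl_continuous.
- by move=> t _; rewrite mulr_ge0 ?powR_ge0 ?expR_ge0.
Qed.

End gamma_function.

Section integral_prod.
Context {R : realType} d1 d2 (T1 : measurableType d1) (T2 : measurableType d2).
Variables (m1 : {measure set T1 -> \bar R}) (m2 : {measure set T2 -> \bar R}).
Local Open Scope ereal_scope.

Lemma ge0_integral_prod (f : T1 -> \bar R) (g : T2 -> \bar R) :
  measurable_fun setT f -> measurable_fun setT g ->
  (forall x, 0 <= f x) -> (forall y, 0 <= g y) ->
  \int[m2]_y \int[m1]_x (f x * g y) = \int[m1]_x f x * \int[m2]_y g y.
Proof.
move=> mf mg f0 g0; rewrite -ge0_integralZl//; last exact: integral_ge0.
by apply: eq_integral => y _; rewrite ge0_integralZr.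
Qed.

End integral_prod.

(** * Legendre's duplication formula *)

Section duplication.
Context {R : realType}.
Notation leb := (@lebesgue_measure R).
Implicit Types s p u v w : R.
Local Open Scope ereal_scope.

(** Integrand of Gamma(s) Gamma(s + 1/2) in logarithmic variables, added to itself with u and v
    exchanged. The symmetrisation creates the factor exp (u/2) + exp (v/2), a multiple of the
    derivative of exp (u/2) - exp (v/2) in u - v at fixed midpoint. *)
Let H s (u v : R) : R :=
  ((expR (u / 2) + expR (v / 2)) * expR (s * u + s * v - expR u - expR v))%R.

Let H_ge0 s u v : (0 <= H s u v)%R.
Proof. by rewrite mulr_ge0 ?expR_ge0// addr_ge0 ?expR_ge0. Qed.

Let measurable_H s d (T : measurableType d) (f g : T -> R) :
  measurable_fun setT f -> measurable_fun setT g ->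
  measurable_fun setT (fun x => (H s (f x) (g x))%:E).
Proof.
move=> mf mg; apply/measurable_EFinP; apply: measurable_funM.
  by apply: measurable_funD; apply: measurableT_comp => //; exact: measurable_funM.
apply: measurableT_comp => //; apply: measurable_funB; last exact: measurableT_comp.
apply: measurable_funB; last exact: measurableT_comp.
by apply: measurable_funD; exact: measurable_funM.
Qed.

Ltac cont := let x := fresh in move=> x;
  apply/differentiable_continuous/derivable1_diffP; exact: ex_derive.

Let continuous_H1 s v : continuous (H s ^~ v).
Proof. rewrite /H; cont. Qed.

Let continuous_Hw s w : continuous (fun v => H s (w + v)%R v).
Proof. rewrite /H; cont. Qed.

Let Gamma_mul s : (0 < s)%R ->
  (2 * (Gamma s * Gamma (s + 1 / 2)))%:E =
  \int[leb]_v \int[leb]_u (H s u v)%:E.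
Proof.
move=> s0; have s20 : (0 < s + 1 / 2)%R by rewrite addr_gt0// divr_gt0.
move: (Gamma_EFin s0) (Gamma_EFin s20); move: (Gamma s) (Gamma (s + 1 / 2)) => A B eA eB.
have mG a : measurable_fun setT (fun u : R => (gammaT a u)%:E).
  by apply/measurable_EFinP; exact: measurable_gammaT.
have G0 a u : 0 <= (gammaT a u)%:E by rewrite lee_fin expR_ge0.
have G00 a b u v : 0 <= (gammaT a u * gammaT b v)%:E.
  by rewrite lee_fin mulr_ge0 ?expR_ge0.
pose g a b (z : R * R) := (gammaT a z.1 * gammaT b z.2)%:E.
have mg a b : measurable_fun setT (g a b).
  apply/measurable_EFinP; apply: measurable_funM;
    (apply: measurableT_comp; first exact: measurable_gammaT) => //.
have g0 a b z : 0 <= g a b z by rewrite lee_fin mulr_ge0 ?expR_ge0.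
have mg1 a b v : measurable_fun setT (fun u => g a b (u, v)).
  exact: measurableT_comp.
have mg2 a b : measurable_fun setT (fun v => \int[leb]_u g a b (u, v)).
  exact: (measurable_fun_fubini_tonelli_G (m1 := leb) (g a b) (mg a b) (g0 a b)).
have -> : (2 * (A * B) = A * B + B * A)%R by ring.
rewrite EFinD !EFinM eA eB -(ge0_integral_prod leb leb (mG s) (mG (s + 1 / 2)%R) (G0 _) (G0 _)).
rewrite -(ge0_integral_prod leb leb (mG (s + 1 / 2)%R) (mG s) (G0 _) (G0 _)).
under [X in X + _ = _]eq_integral do under eq_integral do rewrite -EFinM.
under [X in _ + X = _]eq_integral do under eq_integral do rewrite -EFinM.
rewrite -ge0_integralD//; first last.
- exact: mg2.
- by move=> v _; apply: integral_ge0 => u _; exact: G00.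
- exact: mg2.
- by move=> v _; apply: integral_ge0 => u _; exact: G00.
apply: eq_integral => v _; rewrite -ge0_integralD//; first last.
- exact: mg1.
- exact: mg1.
apply: eq_integral => u _.
rewrite -EFinD /gammaT /H; congr EFin; rewrite [RHS]mulrDl -!expRD addrC.
by congr (_ + _)%R; congr expR; field.
Qed.

(** With u = p + w/2 and v = p - w/2 this is exp (u/2) - exp (v/2). Its square is exp u + exp v - 2
    exp p, so the exponent of [H] splits into a Gaussian one in [F p w] and one in p alone. *)
Let F p w : R := (expR (p / 2) * (expR (w / 4) - expR (- (w / 4))))%R.
Let F' p w : R := (expR (p / 2) * (expR (w / 4) + expR (- (w / 4))) / 4)%R.

Let F_derive p w : is_derive w (1%R : R) (F p) (F' p w).
Proof.
apply: is_derive_eq; rewrite /F' /GRing.scale/=.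
by field.
Qed.

Let range_F p : range (F p) = setT.
Proof.
have cF : continuous (F p) by rewrite /F; cont.
apply/seteqP; split => // y _.
(* Chosen so that exp (p/2) K / 4 = |y|; then exp z >= 1 + z gives F p K >= |y|, and [F p] is
   odd. *)
pose K := (4 * (`|y| * expR (- (p / 2))))%R.
have K0 : (0 <= K)%R by rewrite !mulr_ge0 ?expR_ge0.
have KN : (- K <= K)%R by lra.
have FK : (`|y| <= F p K)%R.
  have e1 := expR_ge1Dx (K / 4); have e2 : (expR (- (K / 4)) <= 1)%R.
    by rewrite expR_le1; lra.
  have -> : (`|y| = expR (p / 2) * (K / 4))%R.
    rewrite /K [(4 * _)%R]mulrC mulfK// mulrCA expRN divff ?expR_eq0 ?mulr1//.
  by rewrite ler_pM2l ?expR_gt0//; lra.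
have FN : F p (- K) = (- F p K)%R by rewrite /F mulNr opprK -[RHS]mulrN opprB.
have := @IVT _ (F p) (- K)%R K y KN (continuous_subspaceT cF).
rewrite FN; have FK0 : (- F p K <= F p K)%R by have := normr_ge0 y; lra.
rewrite min_l ?max_r// => /(_ _)[].
  by move: FK; rewrite ler_norml.
by move=> c _ <-; exists c.
Qed.

(** In the midpoint p and the difference w of the two logarithmic variables, the integral over w is
    a Gauss integral, whence sqrt pi, and the integral over p is that of Gamma(2 s) up to a
    shift. *)
Lemma Gamma_duplication s : (0 < s)%R ->
  (Gamma s * Gamma (s + 1 / 2) = 2 * Num.sqrt pi * 4 `^ (- s) * Gamma (2 * s))%R.
Proof.
move=> s0; apply: (@mulfI _ 2%R) => //; apply: EFin_inj.
rewrite Gamma_mul//.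
(* Here u = w + v at fixed v; after Tonelli, v = p - w/2 at fixed w. Two affine changes of one
   variable stand for the change of variables in the plane. *)
under eq_integral => v _ do
  rewrite (ge0_integral_affine v ltr01 (@continuous_H1 s v))// mul1e.
under eq_integral do under eq_integral do rewrite mul1r.
rewrite -(fubini_tonelli (m1 := leb) (m2 := leb) (fun z => (H s (z.1 + z.2)%R z.2)%:E))/=; first last.
- by move=> z; rewrite lee_fin.
- by apply: measurable_H => //; exact: measurable_funD.
under eq_integral => w _ do
  rewrite (ge0_integral_affine (- (w / 2)) ltr01 (@continuous_Hw s w))// mul1e.
rewrite (fubini_tonelli (m1 := leb) (m2 := leb)
  (fun z => (H s (z.1 + (1 * z.2 + - (z.1 / 2))) (1 * z.2 + - (z.1 / 2)))%R%:E))/=; first last.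
- by move=> z; rewrite lee_fin.
- have mw : measurable_fun setT (fun z : R * R => 1 * z.2 + - (z.1 / 2))%R.
    apply: measurable_funD; first exact: measurable_funM.
    by apply: measurableT_comp => //; exact: measurable_funM.
  by apply: measurable_H => //; exact: measurable_funD.
transitivity (\int[leb]_p ((4 * Num.sqrt pi)%:E * (expR (2 * s * p - 2 * expR p))%:E)).
  apply: eq_integral => p _.
  transitivity (\int[leb]_w ((4 * expR (2 * s * p - 2 * expR p))%:E *
      (gauss_fun (F p w) * F' p w)%:E)).
    apply: eq_integral => w _; rewrite -EFinM; congr EFin.
    rewrite mul1r /H /gauss_fun /F' /F [expR (- (w / 4))]expRN.
    set E := expR (p / 2); set a := expR (w / 4).
    have a0 : a != 0%R by rewrite expR_eq0.
    have -> : expR ((w + (p - w / 2)) / 2) = (E * a)%R.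
      by rewrite -expRD; congr expR; field.
    have -> : expR ((p - w / 2) / 2) = (E * a^-1)%R.
      by rewrite -expRN -expRD; congr expR; field.
    have -> : expR (w + (p - w / 2)) = ((E * a) ^+ 2)%R.
      by rewrite -expRD -expRM_natl; congr expR; field.
    have -> : expR (p - w / 2) = ((E * a^-1) ^+ 2)%R.
      by rewrite -expRN -expRD -expRM_natl; congr expR; field.
    have -> : expR p = (E ^+ 2)%R by rewrite -expRM_natl; congr expR; field.
    transitivity ((E * a + E * a^-1) * (expR (2 * s * p - 2 * E ^+ 2) *
        expR (- (E * (a - a^-1)) ^+ 2)))%R; last by field.
    by rewrite -expRD; congr (_ * expR _)%R; field.
  rewrite ge0_integralZl//; first last.
  - move=> w _; rewrite lee_fin !mulr_ge0 ?expR_ge0 ?addr_ge0 ?expR_ge0//.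
  - apply/measurable_EFinP; apply: measurable_funM.
      apply: measurableT_comp; first exact: measurable_gauss_fun.
      by apply: continuous_measurable_fun; rewrite /F; cont.
    by apply: continuous_measurable_fun; rewrite /F'; cont.
  rewrite -(ge0_integral_range (F_derive p))//; first last.
  - by move=> x _; exact: gauss_fun_ge0.
  - by move=> x _; exact: continuous_gauss_fun.
  - by move=> w; rewrite !mulr_gt0 ?expR_gt0 ?addr_gt0 ?expR_gt0 ?invr_gt0.
  - by rewrite /F'; cont.
  by rewrite range_F integralT_gauss -!EFinM; congr EFin; ring.
rewrite ge0_integralZl//; first last.
- by apply/measurable_EFinP; apply: continuous_measurable_fun; cont.
have s20 : (0 < 2 * s)%R by rewrite mulr_gt0.
have -> : (2 * (2 * Num.sqrt pi * 4 `^ (- s) * Gamma (2 * s)))%:E =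
  (4 * Num.sqrt pi)%:E * ((4 `^ (- s))%:E * (Gamma (2 * s))%:E) :> \bar R.
  by rewrite -!EFinM; congr EFin; ring.
congr (_ * _).
(* The shift by ln 2 doubles exp p and costs the factor 2^(2 s) = 4^s. *)
rewrite Gamma_EFin// (ge0_integral_affine (ln 2) ltr01 (@continuous_gammaT R (2 * s)))//.
rewrite mul1e -ge0_integralZl//; first last.
- by move=> p _; rewrite lee_fin expR_ge0.
- by apply/measurable_EFinP; apply: continuous_measurable_fun; rewrite /gammaT; cont.
apply: eq_integral => p _; rewrite -EFinM; congr EFin.
rewrite /gammaT mul1r [expR (p + _)]expRD lnK ?posrE//.
have -> : (4 `^ (- s) = expR (- (2 * s) * ln 2))%R.
  have e4 : (4 = 2 `^ 2%:R :> R)%R by rewrite powR_mulrn// -natrX.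
  by rewrite mulrC expRM lnK ?posrE// -mulrN [RHS]powRrM -e4.
by rewrite -expRD; congr expR; ring.
by move=> u; exact: expR_ge0.
Qed.

End duplication.

(** * Power series and Laplace transform of the matching density *)

Section series_lemmas.
Context {R : realType}.
Implicit Types (u v : nat -> R) (c l y : R).

Lemma cvg_seriesMl u c l : series u @ \oo --> l ->
  series (fun k => c * u k) @ \oo --> c * l.
Proof.
move=> ul; rewrite (_ : series _ = fun n => c * series u n).
  exact: (@cvgMl_tmp _ _ _ _ _ c l ul).
by apply/funext => n; rewrite /series/= mulr_sumr.
Qed.

Lemma cvg_series_expR y : series (fun k => y ^+ k / k`!%:R) @ \oo --> expR y.
Proof. exact: is_cvg_series_exp_coeff. Qed.

Lemma cvg_series_le u v l m : series u @ \oo --> l -> series v @ \oo --> m ->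
  (forall k, u k <= v k) -> l <= m.
Proof.
move=> ul vm uv; rewrite -(cvg_lim _ ul)// -(cvg_lim _ vm)//.
by apply: lim_series_le => //; apply/cvg_ex; [exists l|exists m].
Qed.

Lemma cvg_series_head l : series (fun k => (k == 0)%:R * l) @ \oo --> l.
Proof.
rewrite -cvg_shiftS; apply: cvg_near_cst; apply: nearW => n.
rewrite /series /= big_nat_recl//= mul1r big1_seq ?addr0// => i _.
by rewrite mul0r.
Qed.

End series_lemmas.

Section bessel_sum.
Context {R : realType}.
Implicit Types (a b c mu x y : R).

(** For nu = b - 1/2, I_nu(z) = (z/2)^nu [bessel_sum b ((z/2)^2)]. Without the power, the series
    still makes sense at y = 0, the value needed when a = 2 / mu^2. *)
Definition bessel_sum b y : R :=
  limn (series (fun k => y ^+ k / (k`!%:R * Gamma (b + k%:R + 1 / 2)))).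

(** A lower bound of Gamma at all positive arguments. It dominates every [bessel_sum b] by one
    multiple of the exponential series, uniformly in b, as a mixture with arbitrary shapes
    requires. *)
Let g0 : R := expR (- expR 1).

Let Gamma_shift_ge b k : 0 < b -> g0 <= Gamma (b + k%:R + 1 / 2).
Proof. by move=> b0; apply: Gamma_ge; rewrite ltr_wpDr ?divr_ge0 ?ltr_wpDr. Qed.

Let term_le b y k : 0 < b -> 0 <= y ->
  y ^+ k / (k`!%:R * Gamma (b + k%:R + 1 / 2)) <= g0^-1 * (y ^+ k / k`!%:R).
Proof.
move=> b0 y0; have := Gamma_shift_ge k b0; move: (Gamma _) => G gG.
have G0 : 0 < G by rewrite (lt_le_trans _ gG)// expR_gt0.
rewrite invfM mulrA mulrC ler_wpM2r ?divr_ge0 ?exprn_ge0// lef_pV2 ?posrE//.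
exact: expR_gt0.
Qed.

Let term_ge0 b y k : 0 < b -> 0 <= y ->
  0 <= y ^+ k / (k`!%:R * Gamma (b + k%:R + 1 / 2)).
Proof.
move=> b0 y0; have := Gamma_shift_ge k b0; move: (Gamma _) => G gG.
by rewrite divr_ge0 ?exprn_ge0// mulr_ge0// (le_trans _ gG)// expR_ge0.
Qed.

Let cvg_g0 y : series (fun k => g0^-1 * (y ^+ k / k`!%:R)) @ \oo --> g0^-1 * expR y.
Proof. exact/cvg_seriesMl/cvg_series_expR. Qed.

Lemma cvg_bessel_sum b y : 0 < b -> 0 <= y ->
  series (fun k => y ^+ k / (k`!%:R * Gamma (b + k%:R + 1 / 2))) @ \oo -->
  bessel_sum b y.
Proof.
move=> b0 y0; suff : cvgn (series (fun k => y ^+ k /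
    (k`!%:R * Gamma (b + k%:R + 1 / 2)))) by [].
apply: (@series_le_cvg _ _ (fun k => g0^-1 * (y ^+ k / k`!%:R))).
- by move=> k; exact: term_ge0.
- by move=> k; rewrite mulr_ge0 ?invr_ge0 ?expR_ge0// divr_ge0// exprn_ge0.
- by move=> k; exact: term_le.
- by apply/cvg_ex; eexists; exact: cvg_g0.
Qed.

Lemma bessel_sum_le b y : 0 < b -> 0 <= y ->
  bessel_sum b y <= (expR (- expR 1))^-1 * expR y.
Proof.
move=> b0 y0; refine (cvg_series_le (cvg_bessel_sum b0 y0) (@cvg_g0 y) _) => k.
exact: term_le.
Qed.

(** The sum lies between its term of index 0, the other terms being nonnegative, and that term plus
    the tail of the dominating exponential series. *)
Lemma cvg_bessel_sum0 b : 0 < b ->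
  bessel_sum b y @[y --> 0^'+] --> (Gamma (b + 1 / 2))^-1.
Proof.
move=> b0; set G := (Gamma _)^-1.
have lb y : 0 <= y -> G <= bessel_sum b y.
  move=> y0; refine (cvg_series_le (@cvg_series_head R G) (cvg_bessel_sum b0 y0) _).
  case=> [|k] /=; first by rewrite /G mulr0n addr0 expr0 fact0 !mul1r.
  by rewrite mul0r; exact: term_ge0.
have ub y : 0 <= y -> bessel_sum b y <= G + g0^-1 * (expR y - 1).
  move=> y0; have cu : series (fun k => (k == 0)%:R * (G - g0^-1) +
      g0^-1 * (y ^+ k / k`!%:R)) @ \oo --> (G - g0^-1) + g0^-1 * expR y.
    rewrite [X in X @ _](_ : _ = series (fun k => (k == 0)%:R * (G - g0^-1)) +
      series (fun k => g0^-1 * (y ^+ k / k`!%:R))); last by rewrite -seriesD.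
    by apply: cvgD; [exact: cvg_series_head|exact: cvg_g0].
  rewrite (_ : G + _ = (G - g0^-1) + g0^-1 * expR y); last by ring.
  refine (cvg_series_le (cvg_bessel_sum b0 y0) cu _); case=> [|k] /=.
    by rewrite /G mulr0n addr0 expr0 fact0 !mul1r ?invr1 ?divr1 ?mulr1 subrK.
  by rewrite mul0r add0r; exact: term_le.
apply: (@squeeze_cvgr _ _ _ _ (cst G) (fun y => G + g0^-1 * (expR y - 1))).
- near=> y; have y0 : 0 <= y by near: y; exact: nbhs_right_ge.
  by rewrite lb ?ub.
- exact: cvg_cst.
- apply: cvg_at_right_filter.
  rewrite -[X in _ --> X](_ : G + g0^-1 * (expR 0 - 1) = G); last first.
    by rewrite expR0 subrr mulr0 addr0.
  apply: cvgD; first exact: cvg_cst.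
  apply: cvgM; first exact: cvg_cst.
  by apply: cvgB; [exact: continuous_expR|exact: cvg_cst].
Unshelve. all: by end_near. Qed.

(* What is left of matching_term_at once the power series of the Bessel
   function is factored out. *)
Definition matching_coef mu a b x : R :=
  2 * Num.sqrt pi * 2 `^ (- b) / (Gamma b * a `^ b) *
  (x `^ (2 * b - 1) * expR (- mu * x)).

Lemma powR_expR x y : 0 < x -> x `^ y = expR (y * ln x).
Proof. by move=> x0; rewrite /powR gt_eqF. Qed.

(** The power c^(b - 1/2) coming from the Bessel function cancels the one in the denominator, so c
    survives only in the argument of [bessel_sum], where c = 0 is harmless. *)
Lemma matching_term_atE mu a b c x : 0 < a -> 0 < b -> 0 < c -> 0 < x ->
  matching_term_at mu a b c x = matching_coef mu a b x * bessel_sum b ((x * c / 2) ^+ 2).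
Proof.
move=> a0 b0 c0 x0; have xc0 : 0 < x * c / 2 by rewrite divr_gt0 ?mulr_gt0.
rewrite /matching_term_at.
have -> : besselI (b - 1 / 2) (x * c) =
    (x * c / 2) `^ (b - 1 / 2) * bessel_sum b ((x * c / 2) ^+ 2).
  apply/cvg_lim => //; rewrite [X in X @ _](_ : _ = series (fun k =>
    (x * c / 2) `^ (b - 1 / 2) * (((x * c / 2) ^+ 2) ^+ k /
    (k`!%:R * Gamma (b + k%:R + 1 / 2))))).
    by apply: cvg_seriesMl; apply: cvg_bessel_sum; rewrite ?exprn_ge0 ?ltW.
  congr series; apply/funext => k.
  rewrite mulrA; congr (_ / (_ * Gamma _)); last by lra.
  rewrite [LHS]powRD; last by apply/implyP => _; rewrite gt_eqF.
  by rewrite -natrM powR_mulrn ?(ltW xc0)// exprM mulrC.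
rewrite mulrA; congr (_ * _).
rewrite /matching_coef sqrtrM// -!powR12_sqrt ?pi_ge0 ?(ltW a0)//.
rewrite !powR_expR ?pi_gt0// ?divr_gt0 ?mulr_gt0// !ln_div ?posrE ?mulr_gt0//.
rewrite !lnM ?posrE ?mulr_gt0//.
move: (Gamma b) => G.
(* Every power is now an exponential of logarithms; once the factors are lined up and 2 is written
   as exp (ln 2), only the exponents have to be compared. *)
rewrite !invfM -!expRN -!mulrA.
rewrite [LHS](_ : _ = G^-1 * (expR (2^-1 * ln 2) * (expR (2^-1 * ln pi) *
  (expR (- mu * x) * (expR (- (2^-1 * ln a)) * (expR ((b - 1 / 2) * (ln x - (ln a + ln c))) *
   expR ((b - 1 / 2) * (ln x + ln c - ln 2)))))))); last by ring.
rewrite [RHS](_ : _ = G^-1 * (2 * (expR (2^-1 * ln pi) * (expR (- b * ln 2) *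
  (expR (- (b * ln a)) * (expR ((2 * b - 1) * ln x) * expR (- mu * x))))))); last by ring.
rewrite -[X in _ = _ * (X * _)](@lnK R 2) ?posrE//.
by rewrite -!expRD; congr (_ * expR _); field.
Qed.

(** Only the square of c enters [bessel_sum], so the square root disappears and one formula covers
    both the regular case and the limit case a = 2 / mu^2. *)
Lemma matching_termE mu a b x : 0 < mu -> 2 / mu ^+ 2 <= a -> 0 < b -> 0 < x ->
  matching_term mu a b x =
  matching_coef mu a b x * bessel_sum b (x ^+ 2 / 4 * (mu ^+ 2 - 2 / a)).
Proof.
move=> mu0 a_ge b0 x0.
have a0 : 0 < a by rewrite (lt_le_trans _ a_ge)// divr_gt0// exprn_gt0.
rewrite /matching_term; case: ifPn => [/eqP aE|an].
  have -> : mu ^+ 2 - 2 / a = 0.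
    by rewrite aE invfM invrK mulrA mulfV// mul1r subrr.
  have -> : bessel_sum b (x ^+ 2 / 4 * 0) = (Gamma (b + 1 / 2))^-1.
    rewrite mulr0; apply/cvg_lim => //.
    rewrite [X in series X](_ : _ = fun k => (k == 0)%:R * (Gamma (b + 1 / 2))^-1).
      exact: cvg_series_head.
    apply/funext => -[|k] /=; first by rewrite mulr0n addr0 expr0 fact0 !mul1r.
    by rewrite expr0n/= !mul0r.
  apply/cvg_lim => //.
  apply: (@cvg_trans _ ((fun c => matching_coef mu a b x *
      bessel_sum b ((x * c / 2) ^+ 2)) @ 0^'+)).
    apply: near_eq_cvg; near=> c.
    by rewrite matching_term_atE//; near: c; exact: nbhs_right_gt.
  apply: cvgMl_tmp.
  apply: (cvg_comp (fun c => (x * c / 2) ^+ 2) (bessel_sum b) _ (cvg_bessel_sum0 b0)).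
  have cq : (fun c => (x * c / 2) ^+ 2) @ (0 : R) --> (0 : R).
    have cc : continuous (fun c => (x * c / 2) ^+ 2).
      by move=> c; apply/differentiable_continuous/derivable1_diffP; exact: ex_derive.
    by have := cc 0; rewrite /continuous_at mulr0 mul0r expr0n.
  move=> Q nQ.
  have h : nbhs (0 : R) (fun c => 0 < (x * c / 2) ^+ 2 -> Q ((x * c / 2) ^+ 2)).
    exact: cq _ nQ.
  (* The filter [0^'+] sees only c > 0, where the argument of [bessel_sum b] is positive as well, so
     its limit from the right applies. *)
  change (nbhs (0 : R) (fun c => 0 < c -> Q ((x * c / 2) ^+ 2))).
  apply: filterS h => c /= h c0; apply: h.
  by rewrite exprn_gt0// divr_gt0 ?mulr_gt0.
have c0 : 0 < mu ^+ 2 - 2 / a.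
  rewrite subr_gt0 ltr_pdivrMr// mulrC -ltr_pdivrMr ?exprn_gt0//.
  by rewrite lt_neqAle eq_sym an.
rewrite matching_term_atE ?sqrtr_gt0//; congr (_ * bessel_sum _ _).
rewrite !exprMn sqr_sqrtr ?ltW//; field.
by rewrite gt_eqF.
Unshelve. all: by end_near. Qed.

End bessel_sum.

Section integral_series.
Context {R : realType} d (T : measurableType d).
Variables (m : {measure set T -> \bar R}) (D : set T).
Implicit Types (u : nat -> T -> R) (U : T -> R).

Lemma measurable_fun_series u U : (forall k, measurable_fun D (u k)) ->
  (forall x, D x -> series (u ^~ x) @ \oo --> U x) -> measurable_fun D U.
Proof.
move=> mu uU; apply: (@measurable_fun_cvg _ _ _ D (fun n x => series (u ^~ x) n)) => //.
by move=> n; apply: measurable_sum.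
Qed.

Lemma ge0_integral_series u U : measurable D ->
  (forall k, measurable_fun D (u k)) -> (forall k x, D x -> 0 <= u k x) ->
  (forall x, D x -> series (u ^~ x) @ \oo --> U x) ->
  (\int[m]_(x in D) (U x)%:E = \sum_(k <oo) \int[m]_(x in D) (u k x)%:E)%E.
Proof.
move=> mD mu u0 uU; rewrite -integral_nneseries//.
- apply: eq_integral => x /[!inE] Dx; rewrite -(cvg_lim _ (uU x Dx))//.
  rewrite -EFin_lim; last by apply/cvg_ex; exists (U x); exact: uU.
  by congr (limn _); apply/funext => n; rewrite /= /series/= sumEFin.
- by move=> k; apply/measurable_EFinP.
Qed.

End integral_series.

(** * Laplace transforms of the mixture and of the matching density *)

Section laplace.
Context {R : realType}.
Notation leb := (@lebesgue_measure R).
Notation Rpos := (`]0%R, +oo[%classic : set R).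
Implicit Types (mu a b x t l : R) (k : nat).

(** From exp (- t / a) = exp (- mu^2 t / 2) exp ((mu^2 - 2 / a) t / 2), with the second factor
    expanded. The rate mu^2 / 2 is free of a, and each term has an explicit transform. *)
Definition gamma_term mu a b k t : R :=
  ((mu ^+ 2 - 2 / a) / 2) ^+ k / k`!%:R / (Gamma b * a `^ b) *
  (t `^ (b + k%:R - 1) * expR (- (mu ^+ 2 / 2 * t))).

(** In x it is a Gamma density of shape 2 (b + k) and rate mu up to a factor, against shape b + k
    and rate mu^2 / 2 for [gamma_term]; the doubled shape is what calls for the duplication
    formula. *)
Definition bessel_term mu a b k x : R :=
  2 * Num.sqrt pi * 2 `^ (- b) / (Gamma b * a `^ b) *
  (((mu ^+ 2 - 2 / a) / 4) ^+ k / (k`!%:R * Gamma (b + k%:R + 1 / 2))) *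
  (x `^ (2 * (b + k%:R) - 1) * expR (- (mu * x))).

Lemma Rpos_gt0 x : Rpos x -> 0 < x.
Proof. by rewrite /= in_itv/= andbT. Qed.

Lemma cvg_gamma_term mu a b t : 0 < a -> 0 < b -> 0 < t ->
  series (fun k => gamma_term mu a b k t) @ \oo --> gamma_pdf a b t.
Proof.
move=> a0 b0 t0.
pose K := t `^ (b - 1) * expR (- (mu ^+ 2 / 2 * t)) / (Gamma b * a `^ b).
have -> : gamma_pdf a b t = K * expR ((mu ^+ 2 - 2 / a) / 2 * t).
  rewrite /gamma_pdf /K.
  have -> : expR (- t / a) =
      expR (- (mu ^+ 2 / 2 * t)) * expR ((mu ^+ 2 - 2 / a) / 2 * t).
    by rewrite -expRD; congr expR; field; exact: lt0r_neq0.
  by move: (Gamma b) (expR _) (expR _) => G e1 e2; ring.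
rewrite (_ : (fun k => _) = fun k => K * (((mu ^+ 2 - 2 / a) / 2 * t) ^+ k / k`!%:R)).
  by apply: cvg_seriesMl; exact: cvg_series_expR.
apply/funext => k; rewrite /gamma_term /K; move: (Gamma b) => G.
have -> : t `^ (b + k%:R - 1) = t `^ (b - 1) * t ^+ k.
  rewrite addrAC [LHS]powRD; last by apply/implyP => _; rewrite gt_eqF.
  by rewrite powR_mulrn ?ltW.
rewrite !exprMn; ring.
Qed.

Lemma cvg_bessel_term mu a b x : 0 < mu -> 2 / mu ^+ 2 <= a -> 0 < b -> 0 < x ->
  series (fun k => bessel_term mu a b k x) @ \oo --> matching_term mu a b x.
Proof.
move=> mu0 a_ge b0 x0; rewrite matching_termE//.
have a0 : 0 < a by rewrite (lt_le_trans _ a_ge)// divr_gt0// exprn_gt0.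
have c0 : 0 <= mu ^+ 2 - 2 / a.
  by rewrite subr_ge0 ler_pdivrMr// mulrC -ler_pdivrMr ?exprn_gt0.
rewrite (_ : (fun k => _) = fun k => matching_coef mu a b x *
    ((x ^+ 2 / 4 * (mu ^+ 2 - 2 / a)) ^+ k / (k`!%:R * Gamma (b + k%:R + 1 / 2)))).
  apply: cvg_seriesMl; apply: cvg_bessel_sum => //.
  by rewrite mulr_ge0// divr_ge0// exprn_ge0// ltW.
apply/funext => k; rewrite /bessel_term /matching_coef.
have -> : x `^ (2 * (b + k%:R) - 1) = x `^ (2 * b - 1) * (x ^+ 2) ^+ k.
  rewrite -exprM -powR_mulrn ?ltW// -powRD; last first.
    by apply/implyP => _; rewrite gt_eqF.
  congr (_ `^ _); rewrite natrM; ring.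
move: (Gamma b) (Gamma _) => G1 G2; rewrite mulNr !exprMn; ring.
Qed.

Lemma gamma_term_ge0 mu a b k t : 0 < mu -> 2 / mu ^+ 2 <= a -> 0 < b ->
  0 <= gamma_term mu a b k t.
Proof.
move=> mu0 a_ge b0.
have a0 : 0 < a by rewrite (lt_le_trans _ a_ge)// divr_gt0// exprn_gt0.
have c0 : 0 <= mu ^+ 2 - 2 / a.
  by rewrite subr_ge0 ler_pdivrMr// mulrC -ler_pdivrMr ?exprn_gt0.
apply: mulr_ge0; last by rewrite mulr_ge0 ?powR_ge0 ?expR_ge0.
rewrite divr_ge0 ?mulr_ge0 ?powR_ge0 ?(ltW (Gamma_gt0 b0))//.
by rewrite exprn_ge0// divr_ge0.
Qed.

Lemma bessel_term_ge0 mu a b k x : 0 < mu -> 2 / mu ^+ 2 <= a -> 0 < b ->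
  0 <= bessel_term mu a b k x.
Proof.
move=> mu0 a_ge b0.
have a0 : 0 < a by rewrite (lt_le_trans _ a_ge)// divr_gt0// exprn_gt0.
have c0 : 0 <= mu ^+ 2 - 2 / a.
  by rewrite subr_ge0 ler_pdivrMr// mulrC -ler_pdivrMr ?exprn_gt0.
have G1 := Gamma_gt0 b0.
have : 0 < Gamma (b + k%:R + 1 / 2).
  by apply: Gamma_gt0; rewrite ltr_wpDr ?divr_ge0 ?ltr_wpDr.
rewrite /bessel_term; move: (Gamma b) (Gamma _) G1 => G1 G2 G10 G20.
apply: mulr_ge0; last by rewrite mulr_ge0 ?powR_ge0 ?expR_ge0.
apply: mulr_ge0.
  by rewrite divr_ge0 ?mulr_ge0 ?powR_ge0 ?sqrtr_ge0// ltW.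
by rewrite divr_ge0 ?exprn_ge0 ?divr_ge0// mulr_ge0// ltW.
Qed.

Lemma measurable_powR_expR (D : set R) (r c : R) :
  measurable_fun D (fun x : R => x `^ r * expR (- (c * x))).
Proof.
apply: measurable_funTS; apply: measurable_funM; first exact: measurable_powR.
by apply: measurableT_comp => //; apply: measurableT_comp => //; exact: measurable_funM.
Qed.

(* Termwise, the two transforms agree by the duplication formula, since
   mu ^ 2 / 2 + s = (mu + l) ^ 2 / 2. *)
Lemma laplace_termE mu a b k l : 0 < mu -> 2 / mu ^+ 2 <= a -> 0 < b -> 0 <= l ->
  (\int[leb]_(x in Rpos) (expR (- (l * x)) * bessel_term mu a b k x)%:E =
   \int[leb]_(t in Rpos)
     (expR (- ((l * mu + l ^+ 2 / 2) * t)) * gamma_term mu a b k t)%:E)%E.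
Proof.
move=> mu0 a_ge b0 l0; have ml0 : 0 < mu + l by rewrite ltr_pwDl.
have a0 : 0 < a by rewrite (lt_le_trans _ a_ge)// divr_gt0// exprn_gt0.
have c0 : 0 <= mu ^+ 2 - 2 / a.
  by rewrite subr_ge0 ler_pdivrMr// mulrC -ler_pdivrMr ?exprn_gt0.
have bk0 : 0 < b + k%:R by rewrite ltr_wpDr.
pose A := 2 * Num.sqrt pi * 2 `^ (- b) / (Gamma b * a `^ b) *
  (((mu ^+ 2 - 2 / a) / 4) ^+ k / (k`!%:R * Gamma (b + k%:R + 1 / 2))).
pose B := ((mu ^+ 2 - 2 / a) / 2) ^+ k / k`!%:R / (Gamma b * a `^ b).
have A0 : 0 <= A.
  apply: mulr_ge0; rewrite divr_ge0 ?mulr_ge0 ?powR_ge0 ?sqrtr_ge0//.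
  - by rewrite ltW// Gamma_gt0.
  - by rewrite exprn_ge0 ?divr_ge0.
  - by rewrite ltW// Gamma_gt0// ltr_wpDr ?divr_ge0.
have B0 : 0 <= B.
  by rewrite !divr_ge0 ?exprn_ge0 ?divr_ge0 ?mulr_ge0 ?powR_ge0// ltW// Gamma_gt0.
have EA x : expR (- (l * x)) * bessel_term mu a b k x =
    A * (x `^ (2 * (b + k%:R) - 1) * expR (- ((mu + l) * x))).
  rewrite /bessel_term -/A [(mu + l) * x]mulrDl opprD expRD.
  by move: (expR _) (expR _) => e1 e2; ring.
have EB t : expR (- ((l * mu + l ^+ 2 / 2) * t)) * gamma_term mu a b k t =
    B * (t `^ (b + k%:R - 1) * expR (- ((mu + l) ^+ 2 / 2 * t))).
  rewrite /gamma_term -/B.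
  have -> : (mu + l) ^+ 2 / 2 = mu ^+ 2 / 2 + (l * mu + l ^+ 2 / 2) by field.
  move: (l * mu + _) => s; rewrite (mulrDl _ s) opprD expRD.
  by move: (expR _) (expR _) => e1 e2; ring.
under eq_integral do rewrite EA EFinM.
under [RHS]eq_integral do rewrite EB EFinM.
rewrite !ge0_integralZl_EFin//; first last.
- by apply/measurable_EFinP; exact: measurable_powR_expR.
- by move=> x _; rewrite lee_fin mulr_ge0 ?powR_ge0 ?expR_ge0.
- by apply/measurable_EFinP; exact: measurable_powR_expR.
- by move=> x _; rewrite lee_fin mulr_ge0 ?powR_ge0 ?expR_ge0.
rewrite !integral_gamma_scale ?mulr_gt0 ?divr_gt0 ?exprn_gt0//.
rewrite -!EFinM; congr EFin.
have := Gamma_duplication bk0.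
have : 0 < Gamma (b + k%:R + 1 / 2) by rewrite Gamma_gt0// ltr_wpDr ?divr_ge0.
rewrite /A /B; have := Gamma_gt0 b0; move: (Gamma b) (Gamma (b + _ + _)).
move: (Gamma (b + _)) (Gamma (2 * _)) => G1 G2 G3 G4 G30 G40 e.
(* Gamma(b + k) is eliminated in favour of Gamma(2 (b + k)). Once the powers of 2 are split, the
   remaining quantities can be treated as independent and the identity is rational. *)
have -> : G1 = 2 * Num.sqrt pi * 4 `^ (- (b + k%:R)) * G2 / G4.
  by rewrite -e mulfK// gt_eqF.
move: (mu ^+ 2 - 2 / a) (mu + l) ml0 => C M M0.
have -> : (M ^+ 2 / 2) `^ (- (b + k%:R)) =
    M `^ (- (2 * (b + k%:R))) * 2 `^ (b + k%:R).
  rewrite !powR_expR ?divr_gt0 ?exprn_gt0// ln_div ?posrE ?exprn_gt0// lnXn//.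
  by rewrite -expRD; congr expR; rewrite mulr2n; ring.
have -> : 4 `^ (- (b + k%:R)) = 2 `^ (- b) / 2 ^+ k / 2 `^ (b + k%:R) :> R.
  rewrite -(powR_invn k (ler0n R 2)) -powRN (_ : 4 = 2 ^+ 2 :> R); last by rewrite -natrX.
  rewrite !powR_expR ?exprn_gt0// lnXn// -!expRD; congr expR; rewrite mulr2n; ring.
have -> : (C / 2) ^+ k = (C / 4) ^+ k * 2 ^+ k.
  by rewrite -exprMn; congr (_ ^+ _); field.
have : 0 < 2 `^ (b + k%:R) :> R by rewrite powR_gt0.
have : 0 < a `^ b by rewrite powR_gt0.
have : 0 < 2 ^+ k :> R by rewrite exprn_gt0.
have : 0 < k`!%:R :> R by rewrite ltr0n fact_gt0.
move: (2 `^ (b + _)) (2 `^ (- b)) (M `^ _) (a `^ b) (2 ^+ k) ((C / 4) ^+ k) (k`!%:R).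
move=> x1 x2 x3 x4 x5 x6 x7 h7 h5 h4 h1; field.
by rewrite !gt_eqF.
Qed.

Lemma measurable_bessel_term (D : set R) mu a b k : measurable_fun D (bessel_term mu a b k).
Proof. by apply: measurable_funM => //; exact: measurable_powR_expR. Qed.

Lemma measurable_gamma_term (D : set R) mu a b k : measurable_fun D (gamma_term mu a b k).
Proof. by apply: measurable_funM => //; exact: measurable_powR_expR. Qed.

Lemma measurable_matching_term mu a b : 0 < mu -> 2 / mu ^+ 2 <= a -> 0 < b ->
  measurable_fun Rpos (matching_term mu a b).
Proof.
move=> mu0 a_ge b0; apply: (@measurable_fun_series _ _ _ _ (bessel_term mu a b)).
  by move=> k; exact: measurable_bessel_term.
by move=> x /Rpos_gt0 x0; exact: cvg_bessel_term.
Qed.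

Lemma measurable_gamma_pdf (D : set R) a b : measurable_fun D (gamma_pdf a b).
Proof.
apply: measurable_funTS; apply: measurable_funM => //; apply: measurable_funM.
  exact: measurable_powR.
apply: measurableT_comp => //; apply: measurable_funM => //.
Qed.

Lemma laplace_matching_term mu a b l : 0 < mu -> 2 / mu ^+ 2 <= a -> 0 < b -> 0 <= l ->
  (\int[leb]_(x in Rpos) (expR (- (l * x)) * matching_term mu a b x)%:E =
   \int[leb]_(t in Rpos)
     (expR (- ((l * mu + l ^+ 2 / 2) * t)) * gamma_pdf a b t)%:E)%E.
Proof.
move=> mu0 a_ge b0 l0.
have a0 : 0 < a by rewrite (lt_le_trans _ a_ge)// divr_gt0// exprn_gt0.
have me (c : R) : measurable_fun Rpos (fun x : R => expR (- (c * x))).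
  by apply: measurable_funTS; apply: measurableT_comp => //; apply: measurableT_comp.
transitivity (\sum_(k <oo) \int[leb]_(x in Rpos)
    (expR (- (l * x)) * bessel_term mu a b k x)%:E)%E.
  apply: ge0_integral_series => //.
  - by move=> k; apply: measurable_funM; [exact: me|exact: measurable_bessel_term].
  - by move=> k x _; rewrite mulr_ge0 ?expR_ge0 ?bessel_term_ge0.
  - by move=> x /Rpos_gt0 x0; apply: cvg_seriesMl; exact: cvg_bessel_term.
transitivity (\sum_(k <oo) \int[leb]_(t in Rpos)
    (expR (- ((l * mu + l ^+ 2 / 2) * t)) * gamma_term mu a b k t)%:E)%E.
  by apply: eq_eseriesr => k _; exact: laplace_termE.
apply/esym; apply: ge0_integral_series => //.
- by move=> k; apply: measurable_funM; [exact: me|exact: measurable_gamma_term].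
- by move=> k x _; rewrite mulr_ge0 ?expR_ge0 ?gamma_term_ge0.
- by move=> x /Rpos_gt0 x0; apply: cvg_seriesMl; exact: cvg_gamma_term.
Qed.

Lemma matching_term_ge0 mu a b x : 0 < mu -> 2 / mu ^+ 2 <= a -> 0 < b -> 0 < x ->
  0 <= matching_term mu a b x.
Proof.
move=> mu0 a_ge b0 x0; have /cvg_lim <-// := cvg_bessel_term mu0 a_ge b0 x0.
apply: limr_ge; first by apply/cvg_ex; eexists; exact: cvg_bessel_term.
by apply: nearW => n; apply: sumr_ge0 => k _; exact: bessel_term_ge0.
Qed.

Lemma gamma_pdf_ge0 a b t : 0 < b -> 0 <= gamma_pdf a b t.
Proof.
move=> b0; rewrite divr_ge0 ?mulr_ge0 ?powR_ge0 ?expR_ge0//.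
by rewrite ltW// Gamma_gt0.
Qed.

(** After the exponential bound on [bessel_sum], a and b occur through exp (- x^2 / (2 a)), a^(- b),
    1 / Gamma(b) and (x^2 / 2)^b, exactly as in [gamma_pdf] at x^2 / 2. The prefactor depends on x
    and mu only, so the convergent series of f at x^2 / 2 dominates the series of g at x. *)
Lemma matching_term_le mu a b x : 0 < mu -> 2 / mu ^+ 2 <= a -> 0 < b -> 0 < x ->
  matching_term mu a b x <= (expR (- expR 1))^-1 *
    (Num.sqrt pi * x * expR (x ^+ 2 * mu ^+ 2 / 4 - mu * x)) * gamma_pdf a b (x ^+ 2 / 2).
Proof.
move=> mu0 a_ge b0 x0; rewrite matching_termE//.
have a0 : 0 < a by rewrite (lt_le_trans _ a_ge)// divr_gt0// exprn_gt0.
have c0 : 0 <= mu ^+ 2 - 2 / a.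
  by rewrite subr_ge0 ler_pdivrMr// mulrC -ler_pdivrMr ?exprn_gt0.
have y0 : 0 <= x ^+ 2 / 4 * (mu ^+ 2 - 2 / a) by rewrite mulr_ge0// divr_ge0// sqr_ge0.
have M0 : 0 <= matching_coef mu a b x.
  rewrite /matching_coef !mulr_ge0 ?divr_ge0 ?mulr_ge0 ?powR_ge0 ?sqrtr_ge0 ?expR_ge0//.
  by rewrite invr_ge0 mulr_ge0 ?powR_ge0// ltW// Gamma_gt0.
apply: le_trans (ler_wpM2l M0 (bessel_sum_le b0 y0)) _.
rewrite le_eqVlt; apply/orP; left; apply/eqP.
rewrite /matching_coef /gamma_pdf; have := Gamma_gt0 b0; have := expR_gt0 (- expR 1 : R).
move: (Gamma b) (expR (- expR 1)) => G g g_gt0 G_gt0.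
have -> : (x ^+ 2 / 2) `^ (b - 1) = x `^ (2 * b - 1) / x * (2 * 2 `^ (- b)).
  rewrite -[X in _ / X * _](@lnK _ x) ?posrE// -[X in _ * (X * _)](@lnK R 2) ?posrE//.
  rewrite !powR_expR ?divr_gt0 ?exprn_gt0// ln_div ?posrE ?exprn_gt0// lnXn//.
  by rewrite -expRN -!expRD; congr expR; rewrite mulr2n; ring.
have -> : expR (x ^+ 2 / 4 * (mu ^+ 2 - 2 / a)) =
    expR (x ^+ 2 * mu ^+ 2 / 4 - mu * x) * expR (mu * x) * expR (- (x ^+ 2 / 2) / a).
  by rewrite -!expRD; congr expR; field; exact: lt0r_neq0.
rewrite mulNr [expR (- (mu * x))]expRN.
have : 0 < expR (mu * x) by exact: expR_gt0.
move: (expR _) (expR _) (expR _) => e1 e2 e3 e20.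
have : 0 < a `^ b by rewrite powR_gt0.
move: (a `^ b) => A A_gt0; rewrite !invfM; field.
by rewrite !gt_eqF.
Qed.

Section mixture.
Variables (mu : R) (p a b : nat -> R) (f : R -> R).
Hypotheses (mu0 : 0 < mu) (hf : gamma_mixture mu p a b f).

Let p_ge0 n : 0 <= p n. Proof. by have [] := hf. Qed.

Let b_gt0 n : 0 < b n. Proof. by have [] := hf. Qed.

Let a_ge n : 2 / mu ^+ 2 <= a n.
Proof.
have [_ _ _ ha _] := hf; apply: (le_trans ha); apply: ge_inf; last by exists n.
(* The infimum of a set without lower bound is 0 by convention; this would contradict 2 / mu^2 > 0,
   so the scales are bounded below. *)
apply: contrapT => nlb; move: ha; rewrite inf_out; last by move=> [].
by rewrite leNgt divr_gt0// exprn_gt0.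
Qed.

Let cvg_f t : 0 < t -> series (fun n => p n * gamma_pdf (a n) (b n) t) @ \oo --> f t.
Proof. by have [_ _ _ _] := hf; exact. Qed.

Definition matching_density x : R :=
  limn (series (fun n => p n * matching_term mu (a n) (b n) x)).

Let term_ge0 n x : 0 < x -> 0 <= p n * matching_term mu (a n) (b n) x.
Proof. by move=> x0; rewrite mulr_ge0// matching_term_ge0. Qed.

Lemma cvg_matching_density x : 0 < x ->
  series (fun n => p n * matching_term mu (a n) (b n) x) @ \oo --> matching_density x.
Proof.
move=> x0; suff : cvgn (series (fun n => p n * matching_term mu (a n) (b n) x)) by [].
pose C := (expR (- expR 1))^-1 *
    (Num.sqrt pi * x * expR (x ^+ 2 * mu ^+ 2 / 4 - mu * x)).
have C0 : 0 <= C by rewrite !mulr_ge0 ?invr_ge0 ?expR_ge0 ?sqrtr_ge0// ltW.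
apply: (@series_le_cvg _ _ (fun n => C * (p n * gamma_pdf (a n) (b n) (x ^+ 2 / 2)))).
- by move=> n; exact: term_ge0.
- by move=> n; apply: (mulr_ge0 C0); apply: mulr_ge0 => //; exact: gamma_pdf_ge0.
- by move=> n; rewrite [leRHS]mulrCA ler_wpM2l// matching_term_le.
- apply/cvg_ex; eexists; apply: cvg_seriesMl; apply: cvg_f.
  by rewrite divr_gt0// exprn_gt0.
Qed.

Lemma matching_density_ge0 x : 0 < x -> 0 <= matching_density x.
Proof.
move=> x0; apply: limr_ge; first by apply/cvg_ex; eexists; exact: cvg_matching_density.
by apply: nearW => n; apply: sumr_ge0 => k _; exact: term_ge0.
Qed.

Lemma measurable_matching_density : measurable_fun Rpos matching_density.
Proof.
apply: (@measurable_fun_series _ _ _ _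
  (fun n x => p n * matching_term mu (a n) (b n) x)).
  by move=> n; apply: measurable_funM => //; exact: measurable_matching_term.
by move=> x /Rpos_gt0 x0; exact: cvg_matching_density.
Qed.

Let mexp (c : R) : measurable_fun Rpos (fun x : R => expR (- (c * x))).
Proof.
by apply: measurable_funTS; apply: measurableT_comp => //; apply: measurableT_comp.
Qed.

Lemma laplace_matching_density l : 0 <= l ->
  (\int[leb]_(x in Rpos) (expR (- (l * x)) * matching_density x)%:E =
   \int[leb]_(t in Rpos) (expR (- ((l * mu + l ^+ 2 / 2) * t)) * f t)%:E)%E.
Proof.
move=> l0.
transitivity (\sum_(n <oo) \int[leb]_(x in Rpos)
    (p n * (expR (- (l * x)) * matching_term mu (a n) (b n) x))%:E)%E.
  apply: ge0_integral_series => //.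
  - move=> n; apply: measurable_funM => //.
    by apply: measurable_funM; [exact: mexp|exact: measurable_matching_term].
  - by move=> n x /Rpos_gt0 x0; rewrite !mulr_ge0 ?expR_ge0 ?matching_term_ge0.
  - move=> x /Rpos_gt0 x0; under eq_fun do rewrite mulrCA.
    by apply: cvg_seriesMl; exact: cvg_matching_density.
transitivity (\sum_(n <oo) \int[leb]_(t in Rpos)
    (p n * (expR (- ((l * mu + l ^+ 2 / 2) * t)) * gamma_pdf (a n) (b n) t))%:E)%E.
  apply: eq_eseriesr => n _.
  under eq_integral do rewrite EFinM; under [RHS]eq_integral do rewrite EFinM.
  rewrite !ge0_integralZl_EFin//; first by rewrite laplace_matching_term.
  - by move=> t _; rewrite lee_fin mulr_ge0 ?expR_ge0 ?gamma_pdf_ge0.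
  - apply/measurable_EFinP; apply: measurable_funM; [exact: mexp|exact: measurable_gamma_pdf].
  - by move=> x /Rpos_gt0 x0; rewrite lee_fin mulr_ge0 ?expR_ge0 ?matching_term_ge0.
  - apply/measurable_EFinP; apply: measurable_funM; [exact: mexp|exact: measurable_matching_term].
apply/esym; apply: ge0_integral_series => //.
- move=> n; apply: measurable_funM => //.
  by apply: measurable_funM; [exact: mexp|exact: measurable_gamma_pdf].
- move=> n t _; apply: mulr_ge0 => //; apply: mulr_ge0; first exact: expR_ge0.
  exact: gamma_pdf_ge0.
- move=> t /Rpos_gt0 t0; under eq_fun do rewrite mulrCA.
  by apply: cvg_seriesMl; exact: cvg_f.
Qed.

End mixture.

End laplace.

(** * Uniqueness of Laplace transforms *)

Section laplace_uniqueness.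
Context {R : realType}.
Implicit Types (v x y : R) (k n m j : nat).


Lemma bernoulli_exprBl v k : 0 <= v <= 1 -> 1 - k%:R * v <= (1 - v) ^+ k.
Proof.
move=> /andP[v0 v1]; elim: k => [|k ih]; first by rewrite mul0r subr0 expr0.
rewrite exprS; apply: (@le_trans _ _ ((1 - v) * (1 - k%:R * v))); last first.
  by rewrite ler_wpM2l// subr_ge0.
rewrite -natr1; have : 0 <= k%:R * v ^+ 2 by rewrite mulr_ge0// sqr_ge0.
lra.
Qed.

(* The number of factors is chosen so that threshold_exp y n * expR (- n x) tends to 0
   or to +oo, according to x > y or x <= y. *)
Definition threshold_exp y n : nat := (Num.truncn (n.+1%:R * expR (n.+1%:R * y))).+1.

Definition smooth_threshold y n x : R :=
  (1 - expR (- (n.+1%:R * x))) ^+ threshold_exp y n.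

Lemma smooth_threshold_ge0_le1 y n x : 0 <= x -> 0 <= smooth_threshold y n x <= 1.
Proof.
move=> x0; have h0 : 0 <= 1 - expR (- (n.+1%:R * x)).
  by rewrite subr_ge0 expR_le1 oppr_le0 mulr_ge0.
by rewrite exprn_ge0// exprn_ile1// lerBlDr lerDl expR_ge0.
Qed.

(** Let N = n + 1, v = exp (- N x) and m the exponent. If x > y, Bernoulli's inequality bounds the
    defect by m v <= 2 N exp (- N (x - y)), and exp z >= z^2 / 2 makes this at most 4 / ((x - y)^2
    N). If x <= y, (1 - v)^m <= exp (- m v) <= exp (- N); the factor N in m settles the case x =
    y. *)
Lemma cvg_smooth_threshold y x : 0 <= y -> 0 <= x ->
  (fun n => smooth_threshold y n x) @ \oo --> ((y < x)%R%:R : R).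
Proof.
move=> y0 x0.
have v1 n : 0 <= expR (- (n.+1%:R * x)) <= 1.
  by rewrite expR_ge0 expR_le1 oppr_le0 mulr_ge0.
have [xy|xy] := ltP y x.
  apply: (@squeeze_cvgr _ _ _ _ (fun n => 1 - 4 / (x - y) ^+ 2 * harmonic n) (cst 1)).
  - near=> n; have /andP[_ ->] := @smooth_threshold_ge0_le1 y n x x0; rewrite andbT.
    apply: le_trans (bernoulli_exprBl _ (v1 n)); rewrite lerD2l lerN2.
    set N : R := n.+1%:R.
    have N1 : 1 <= N by rewrite ler1n.
    have N0 : 0 < N by rewrite (lt_le_trans _ N1).
    have e1 : 1 <= expR (N * y) by rewrite -expR0 ler_expR mulr_ge0// ltW.
    have m_le : (threshold_exp y n)%:R <= 2 * N * expR (N * y).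
      rewrite /threshold_exp -natr1.
      have : (Num.truncn (N * expR (N * y)))%:R <= N * expR (N * y).
        by rewrite truncn_le// mulr_ge0 ?expR_ge0 ?ltW.
      nra.
    apply: (@le_trans _ _ (2 * N * expR (N * y) * expR (- (N * x)))).
      by rewrite ler_wpM2r// expR_ge0.
    have d0 : 0 < x - y by rewrite subr_gt0.
    have Nd0 : 0 < N * (x - y) by rewrite mulr_gt0.
    rewrite -mulrA -expRD (_ : N * y + - (N * x) = - (N * (x - y))); last by ring.
    rewrite expRN.
    have h : (N * (x - y)) ^+ 2 / 2 <= expR (N * (x - y)).
      have := @expR_ge1Dxn R (N * (x - y)) 1 (ltW Nd0); rewrite (_ : 2`!%:R = 2 :> R)//; lra.
    apply: (@le_trans _ _ (2 * N * ((N * (x - y)) ^+ 2 / 2)^-1)).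
      rewrite ler_wpM2l ?mulr_ge0 ?(ltW N0)// lef_pV2 ?posrE ?expR_gt0//.
      by rewrite divr_gt0// exprn_gt0.
    rewrite /harmonic/= -/N le_eqVlt; apply/orP; left; apply/eqP; field.
    by rewrite !gt_eqF.
  - rewrite -[X in _ --> X](_ : 1 - 4 / (x - y) ^+ 2 * 0 = 1); last by rewrite mulr0 subr0.
    by apply: cvgB; [exact: cvg_cst|apply: cvgMl_tmp; exact: cvg_harmonic].
  - exact: cvg_cst.
apply: (@squeeze_cvgr _ _ _ _ (cst 0) (fun n => expR (- n.+1%:R))).
- near=> n; have /andP[-> _] := @smooth_threshold_ge0_le1 y n x x0; rewrite /=.
  set N : R := n.+1%:R.
  have N0 : 0 <= N by [].
  apply: (@le_trans _ _ (expR (- expR (- (N * x))) ^+ threshold_exp y n)).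
    rewrite lerXn2r ?nnegrE ?expR_ge0 ?subr_ge0//; first by have /andP[] := v1 n.
    by have := expR_ge1Dx (- expR (- (N * x))); rewrite addrC.
  rewrite -expRM_natl ler_expR mulrN lerN2.
  have m_ge : N * expR (N * y) <= (threshold_exp y n)%:R by exact/ltW/truncnS_gt.
  apply: (@le_trans _ _ (N * expR (N * y) * expR (- (N * x)))); last first.
    by rewrite ler_wpM2r// expR_ge0.
  rewrite -mulrA -expRD ler_peMr// -expR0 ler_expR subr_ge0 ler_wpM2l//.
- exact: cvg_cst.
- by have := @cvgn_expR R; rewrite -cvg_shiftS.
Unshelve. all: by end_near. Qed.

Section weighted.
Context d (T : measurableType d) (m : {measure set T -> \bar R}).
Variables (D : set T) (Y w : T -> R).
Hypotheses (mD : measurable D) (mY : measurable_fun D Y) (mw : measurable_fun D w).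
Hypotheses (Y0 : forall t, D t -> 0 <= Y t) (w0 : forall t, D t -> 0 <= w t).
Hypothesis wfin : (\int[m]_(t in D) (w t)%:E < +oo)%E.

(** The k-th finite difference, with step N, of the Laplace transform at j, hence determined by the
    values at the integers. [Y] and [w] are abstract so as to cover both a random variable under P
    and the identity under a density. *)
Definition laplace_diff N k j : \bar R :=
  \int[m]_(t in D)
    (expR (- (j%:R * Y t)) * (1 - expR (- (N%:R * Y t))) ^+ k * w t)%:E.

Let mexpY c : measurable_fun D (fun t => expR (- (c * Y t))).
Proof.
apply: measurableT_comp => //; apply: measurableT_comp => //.
exact: measurable_funM.
Qed.

Let mterm N k j : measurable_fun D
  (fun t => expR (- (j%:R * Y t)) * (1 - expR (- (N%:R * Y t))) ^+ k * w t).
Proof.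
apply: measurable_funM => //; apply: measurable_funM; first exact: mexpY.
by apply: measurable_funX; apply: measurable_funB => //; exact: mexpY.
Qed.

Let exp01 N t : D t -> 0 <= 1 - expR (- (N%:R * Y t)) <= 1.
Proof.
by move=> Dt; rewrite subr_ge0 expR_le1 oppr_le0 mulr_ge0 ?Y0//= lerBlDr lerDl expR_ge0.
Qed.

Let term_ge0 N k j t : D t ->
  0 <= expR (- (j%:R * Y t)) * (1 - expR (- (N%:R * Y t))) ^+ k * w t.
Proof.
move=> Dt; rewrite mulr_ge0 ?w0// mulr_ge0 ?expR_ge0// exprn_ge0//.
by have /andP[] := exp01 N Dt.
Qed.

Let term_le N k j t : D t ->
  expR (- (j%:R * Y t)) * (1 - expR (- (N%:R * Y t))) ^+ k * w t <= w t.
Proof.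
move=> Dt; rewrite ler_piMl ?w0//; have /andP[h0 h1] := exp01 N Dt.
by rewrite mulr_ile1 ?expR_ge0 ?exprn_ge0 ?exprn_ile1// expR_le1 oppr_le0 mulr_ge0 ?Y0.
Qed.

Let mEw : measurable_fun D (EFin \o w). Proof. exact/measurable_EFinP. Qed.

Lemma laplace_diff_fin_num N k j : laplace_diff N k j \is a fin_num.
Proof.
rewrite ge0_fin_numE; last by apply: integral_ge0 => t Dt; rewrite lee_fin term_ge0.
apply: le_lt_trans wfin; apply: ge0_le_integral => //.
- by move=> t Dt; rewrite lee_fin term_ge0.
- by apply/measurable_EFinP; exact: mterm.
- by move=> t Dt; rewrite lee_fin term_le.
Qed.

Lemma laplace_diffS N k j :
  laplace_diff N k.+1 j = (laplace_diff N k j - laplace_diff N k (j + N))%E.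
Proof.
suff <- : (laplace_diff N k.+1 j + laplace_diff N k (j + N) = laplace_diff N k j)%E.
  by rewrite addeK// laplace_diff_fin_num.
rewrite /laplace_diff -ge0_integralD//; last first.
- by apply/measurable_EFinP; exact: mterm.
- by move=> t Dt; rewrite lee_fin term_ge0.
- by apply/measurable_EFinP; exact: mterm.
- by move=> t Dt; rewrite lee_fin term_ge0.
apply: eq_integral => t _; rewrite -EFinD; congr EFin.
by rewrite natrD mulrDl opprD expRD exprS; ring.
Qed.

Lemma cvg_laplace_diff y : 0 <= y ->
  laplace_diff n.+1 (threshold_exp y n) 0 @[n --> \oo] -->
  (\int[m]_(t in D `&` [set t | (y < Y t)%R]) (w t)%:E)%E.
Proof.
move=> y0.
pose F n t := (smooth_threshold y n (Y t) * w t)%:E.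
pose G t := ((y < Y t)%R%:R * w t)%:E.
have FE n t : D t -> F n t = (expR (- (0%:R * Y t)) *
    (1 - expR (- (n.+1%:R * Y t))) ^+ threshold_exp y n * w t)%:E.
  by move=> Dt; rewrite mul0r oppr0 expR0 mul1r.
have FG t : D t -> F ^~ t @ \oo --> G t.
  move=> Dt; apply: cvg_EFin; first by apply: nearW.
  apply: cvgMr_tmp; exact: cvg_smooth_threshold (Y0 Dt).
have mF n : measurable_fun D (F n).
  apply: (eq_measurable_fun (fun t => (expR (- (0%:R * Y t)) *
    (1 - expR (- (n.+1%:R * Y t))) ^+ threshold_exp y n * w t)%:E)).
    by move=> t /[!inE] Dt; rewrite FE.
  by apply/measurable_EFinP; exact: mterm.
have mG : measurable_fun D G by exact: emeasurable_fun_cvg mF FG.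
have iw : m.-integrable D (EFin \o w).
  apply/integrableP; split=> //; under eq_integral => t /[!inE] Dt.
    rewrite /= ger0_norm ?w0//; over.
  exact: wfin.
have Fw t n : D t -> (`|F n t| <= (EFin \o w) t)%E.
  by move=> Dt; rewrite FE// lee_fin ger0_norm ?term_ge0// term_le.
have [_ _] := dominated_convergence mD mF mG (aeW _ FG) iw (aeW _ Fw).
rewrite integral_mkcondr.
rewrite [X in _ --> X -> _](_ : _ = \int[m]_(x in D) ((fun t => (w t)%:E) \_ [set t | (y < Y t)%R]) x)%E; last first.
  apply: eq_integral => t _; rewrite patchE /G; case: ifPn => [/[!inE]/= ->|].
    by rewrite mul1r.
  by rewrite notin_setE/= => /negP/negbTE ->; rewrite mul0r.
apply: cvg_trans; apply: near_eq_cvg; apply: nearW => n.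
by rewrite /laplace_diff; apply: eq_integral => t /[!inE] Dt; rewrite FE.
Qed.

End weighted.

Notation leb := (@lebesgue_measure R).
Notation Rpos := (`]0%R, +oo[%classic : set R).

(** Induction on k equates all finite differences, and their limits equate the masses of the rays
    above any y >= 0; rays with y < 0 have mass 1 on both sides, and rays generate the Borel sets.
    The ray y = 0 rules out an atom of [Y] at 0. *)
Lemma laplace_transform_unique d (T : measurableType d) (P : probability T R)
    (Y : T -> R) (g : R -> R) :
  measurable_fun setT Y -> (forall t, 0 <= Y t) ->
  measurable_fun Rpos g -> (forall x, 0 < x -> 0 <= g x) ->
  (forall j, \int[P]_t (expR (- (j%:R * Y t)))%:E =
     \int[leb]_(x in Rpos) (expR (- (j%:R * x)) * g x)%:E)%E ->
  forall A, measurable A ->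
    P (Y @^-1` A) = (\int[leb]_(x in A `&` Rpos) (g x)%:E)%E.
Proof.
move=> mY Y0 mg g0 YgE.
have mRpos : measurable Rpos by exact: measurable_itv.
have mEg : measurable_fun Rpos (EFin \o g) by exact/measurable_EFinP.
have g0' x : Rpos x -> 0 <= g x by rewrite /= in_itv/= andbT; exact: g0.
have g1 : (\int[leb]_(x in Rpos) (g x)%:E = 1)%E.
  have := YgE 0; under eq_integral do rewrite mul0r oppr0 expR0.
  under [X in _ = X -> _]eq_integral do rewrite mul0r oppr0 expR0 mul1r.
  by rewrite integral_cst// mul1e => <-; exact: probability_setT.
have int1 B : measurable B -> (\int[P]_(t in B) ((cst 1 : T -> R) t)%:E = P B)%E.
  by move=> mB; rewrite -[RHS]mul1e -integral_cst.
have Pfin : (\int[P]_(t in setT) ((cst 1 : T -> R) t)%:E < +oo)%E.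
  by rewrite int1// (le_lt_trans (probability_le1 P measurableT))// ltry.
have gfin : (\int[leb]_(x in Rpos) (g x)%:E < +oo)%E by rewrite g1 ltry.
have Y0' t : setT t -> 0 <= Y t by [].
have m1 : measurable_fun setT (cst 1 : T -> R) by [].
have c0 t : setT t -> 0 <= (cst 1 : T -> R) t by [].
have id0 x : Rpos x -> 0 <= (id : R -> R) x by rewrite /= in_itv/= andbT => /ltW.
have mid : measurable_fun Rpos (id : R -> R) by [].
have diffE N k : forall j, laplace_diff P setT Y (cst 1) N k j =
    laplace_diff leb Rpos (id : R -> R) g N k j.
  elim: k => [|k ih] j.
    rewrite /laplace_diff; under eq_integral do rewrite expr0 !mulr1.
    by under [RHS]eq_integral do rewrite expr0 mulr1.
  by rewrite !laplace_diffS// !ih.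
have rayE y : 0 <= y ->
    P (Y @^-1` `]y, +oo[) = (\int[leb]_(x in `]y, +oo[ `&` Rpos) (g x)%:E)%E.
  move=> y0.
  have cP := @cvg_laplace_diff _ _ P _ _ _ measurableT mY m1 Y0' c0 Pfin _ y0.
  have cg := @cvg_laplace_diff _ _ leb _ _ _ mRpos mid mg id0 g0' gfin _ y0.
  have : laplace_diff P setT Y (cst 1) n.+1 (threshold_exp y n) 0 @[n --> \oo] -->
      (\int[leb]_(t in Rpos `&` [set t | (y < (id : R -> R) t)%R]) (g t)%:E)%E.
    by under eq_fun do rewrite diffE.
  move=> /(cvg_unique _ cP) => /(_ (@ereal_hausdorff R)).
  have setE : [set t | (y < Y t)%R] = Y @^-1` `]y, +oo[.
    by apply/seteqP; split => t /=; rewrite in_itv/= andbT.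
  rewrite setTI int1; last by rewrite setE -[X in measurable X]setTI; exact: mY.
  rewrite setE => ->; rewrite setIC; congr (integral _ (_ `&` _) _).
  by apply/seteqP; split => t /=; rewrite in_itv/= andbT.
move=> A mA.
have mI B : measurable B -> measurable (B `&` Rpos) by move=> mB; exact: measurableI.
have mPre B : measurable B -> measurable (Y @^-1` B).
  by move=> mB; rewrite -[X in measurable X]setTI; exact: mY.
apply: (@dynkin_induction _ _ (@RGenOInfty.G R) (fun B => P (Y @^-1` B) =
  (\int[leb]_(x in B `&` Rpos) (g x)%:E)%E)) => //.
- exact: RGenOInfty.measurableE.
- move=> _ _ [x ->] [y ->]; exists (Num.max x y).
  by apply/seteqP; split => z /=; rewrite !in_itv/= !andbT gt_max; [move=> [-> ->]|move/andP].
- by rewrite preimage_setT probability_setT setTI g1.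
- move=> _ [y ->]; have [y0|y0] := leP 0 y; first exact: rayE.
  rewrite (_ : Y @^-1` _ = setT); last first.
    apply/seteqP; split => // t _ /=; rewrite in_itv/= andbT.
    exact: lt_le_trans y0 _.
  rewrite probability_setT (_ : _ `&` Rpos = Rpos) ?g1//; apply/setIidPr.
  by move=> x /=; rewrite !in_itv/= !andbT; exact: lt_trans.
- move=> B mB PB; rewrite preimage_setC probability_setC; last exact: mPre.
  have : (\int[leb]_(x in (B `&` Rpos) `|` (~` B `&` Rpos)) (g x)%:E = 1)%E.
    by rewrite -setIUl setUv setTI.
  rewrite ge0_integral_setU//=.
  + by rewrite -PB => <-; rewrite [X in (X - _)%E]addeC addeK// fin_num_measure//; exact: mPre.
  + exact: mI.
  + by apply: mI; exact: measurableC.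
  + by rewrite -setIUl setUv setTI.
  + by move=> x [[_ /g0']|[_ /g0']].
  + by rewrite disj_set2E -setIIl setICr set0I.
- move=> F mF tF PF; rewrite preimage_bigcup setI_bigcupl.
  have mU : measurable (\bigcup_k F k) by exact: bigcupT_measurable.
  rewrite ge0_integral_bigcup//=.
  + rewrite measure_bigcup//.
    * rewrite (eq_eseriesl (Q := xpredT)); last by move=> n; rewrite in_setT.
      by apply: eq_eseriesr => n _; exact: PF.
    * by move=> n _; exact: mPre.
    * by move=> i j _ _ [t [Fi Fj]]; apply: tF => //; exists (Y t).
  + by move=> k; exact: mI.
  + rewrite -setI_bigcupl; apply: measurable_funS mEg => //; exact: subIsetr.
  + by move=> x [k _ [_ /g0']].
  + by move=> i j _ _ [t [[Fi _] [Fj _]]]; apply: tF => //; exists t.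
- by have := RGenOInfty.measurableE R; rewrite /measurable/= => <-.
Qed.


End laplace_uniqueness.

(** * The stopped exponential martingale on a grid *)

Section independence.
Context d (T : measurableType d) (R : realType) (P : probability T R).
Local Open Scope ereal_scope.

(** By uniqueness of the product measure the joint law is the product of the laws, and Tonelli's
    theorem separates the integrals. *)
Lemma ge0_integral_indep d1 d2 (T1 : measurableType d1) (T2 : measurableType d2)
    (U : {RV P >-> T1}) (V : {RV P >-> T2}) (f : T1 -> \bar R) (g : T2 -> \bar R) :
  (forall A B, measurable A -> measurable B ->
    P (U @^-1` A `&` V @^-1` B) = P (U @^-1` A) * P (V @^-1` B)) ->
  measurable_fun setT f -> measurable_fun setT g ->
  (forall x, 0 <= f x) -> (forall y, 0 <= g y) ->
  \int[P]_t (f (U t) * g (V t)) = \int[P]_t f (U t) * \int[P]_t g (V t).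
Proof.
move=> UV mf mg f0 g0.
pose UVf : T -> T1 * T2 := fun t => (U t, V t).
have mUV : measurable_fun setT UVf by exact: measurable_fun_pair.
pose UVm := isMeasurableFun.Build _ _ _ _ _ mUV.
pose UVr : {RV P >-> (T1 * T2)%type} := HB.pack UVf UVm.
pose h (z : T1 * T2) := f z.1 * g z.2.
have mh : measurable_fun setT h.
  by apply: emeasurable_funM; apply: measurableT_comp.
have h0 z : 0 <= h z by rewrite mule_ge0.
have e : forall A, measurable A ->
    (distribution P U \x distribution P V) A = distribution P UVr A.
  apply: product_measure_unique => A B mA mB.
  by rewrite -UV.
transitivity (\int[distribution P UVr]_z h z).
  by rewrite ge0_integral_distribution.
transitivity (\int[distribution P U \x distribution P V]_z h z).
  by apply: eq_measure_integral => A mA _; exact/esym/e.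
rewrite fubini_tonelli2//.
rewrite (ge0_integral_prod (distribution P U) (distribution P V) mf mg f0 g0).
by rewrite !ge0_integral_distribution.
Qed.

Variables (G : set (set T)) (V : {RV P >-> R}).
Hypotheses (GI : setI_closed G) (Gm : G `<=` measurable).
Hypothesis GV : forall E B, G E -> measurable B ->
  P (E `&` V @^-1` B) = P E * P (V @^-1` B).

Lemma indep_sigma_algebra E B : <<s G >> E -> measurable B ->
  P (E `&` V @^-1` B) = P E * P (V @^-1` B).
Proof.
move=> GE mB; have sGm := smallest_sub (@sigma_algebra_measurable _ T) Gm.
have mV : measurable (V @^-1` B) by rewrite -[X in measurable X]setTI; exact: measurable_funPT.
have indepC (S : set T) : measurable S -> P (S `&` V @^-1` B) = P S * P (V @^-1` B) ->
    P (~` S `&` V @^-1` B) = P (~` S) * P (V @^-1` B).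
  move=> mS PS.
  have -> : P (~` S `&` V @^-1` B) = P (V @^-1` B) - P (S `&` V @^-1` B).
    rewrite setIC -setDE measureD//; first by rewrite setIC.
    by rewrite -ge0_fin_numE// fin_num_measure.
  by rewrite PS probability_setC// muleBl ?mul1e// ?fin_num_adde_defr ?fin_num_measure.
have indepU (F : (set T)^nat) : (forall n, measurable (F n)) -> trivIset setT F ->
    (forall n, P (F n `&` V @^-1` B) = P (F n) * P (V @^-1` B)) ->
    P (\bigcup_k F k `&` V @^-1` B) = P (\bigcup_k F k) * P (V @^-1` B).
  move=> mF tF PF; rewrite setI_bigcupl.
  rewrite measure_bigcup//; last 2 first.
    by move=> n _; exact: measurableI.
    by move=> i j _ _ [t [[Fi _] [Fj _]]]; apply: tF => //; exists t.
  rewrite measure_bigcup//.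
  rewrite -(@fineK _ (P (V @^-1` B))) ?fin_num_measure// muleC -nneseriesZl//.
  apply: eq_eseriesr => n _.
  by rewrite fineK ?fin_num_measure// muleC; exact: PF.
apply: (@dynkin_induction _ (g_sigma_algebraType G) G
  (fun E => P (E `&` V @^-1` B) = P E * P (V @^-1` B))) => //.
- by rewrite setTI probability_setT mul1e.
- by move=> S GS; exact: GV.
- by move=> S /sGm mS PS; exact: indepC.
- by move=> F mF tF PF; apply: indepU => // n; apply: sGm; exact: mF.
Qed.

(** [U] is a function of the identity map from [T] to [T] with the smaller sigma-algebra. That map
    is a random variable independent of [V], which reduces the claim to two independent
    variables. *)
Lemma ge0_integral_indep_sigma_algebra (U : g_sigma_algebraType G -> \bar R)
    (f : R -> \bar R) :
  measurable_fun setT U -> measurable_fun setT f ->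
  (forall t, 0 <= U t) -> (forall y, 0 <= f y) ->
  \int[P]_t (U t * f (V t)) = \int[P]_t U t * \int[P]_t f (V t).
Proof.
move=> mU mf U0 f0.
pose TG : measurableType _ := g_sigma_algebraType G.
have mid : measurable_fun setT (id : T -> TG).
  move=> _ B mB; rewrite setTI preimage_id.
  exact: (smallest_sub (@sigma_algebra_measurable _ T) Gm).
pose idm := isMeasurableFun.Build _ _ _ _ _ mid.
pose idr : {RV P >-> TG} := HB.pack (id : T -> TG) idm.
apply: (ge0_integral_indep (U := idr) (V := V)) => // A B mA mB.
exact: indep_sigma_algebra.
Qed.

End independence.

Section density.
Context d (T : measurableType d) (R : realType) (P : probability T R).
Notation leb := (@lebesgue_measure R).
Variables (V : {RV P >-> R}) (D : set R) (g : R -> R).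
Hypotheses (mD : measurable D) (mg : measurable_fun D g).
Hypothesis g0 : forall x, D x -> 0 <= g x.
Hypothesis Vg : forall A, measurable A ->
  P (V @^-1` A) = (\int[leb]_(x in A `&` D) (g x)%:E)%E.

Import HBNNSimple.
Local Open Scope ereal_scope.

Let mEg : measurable_fun D (EFin \o g). Proof. exact/measurable_EFinP. Qed.

Let integral_indic_density A : measurable A ->
  \int[P]_t (\1_A (V t))%:E = \int[leb]_(x in D) (\1_A x * g x)%:E.
Proof.
move=> mA; have mVA : measurable (V @^-1` A).
  by rewrite -[X in measurable X]setTI; exact: measurable_funPT.
transitivity (\int[P]_t (\1_(V @^-1` A) t)%:E); first exact: eq_integral.
transitivity (P (V @^-1` A)); first by rewrite integral_indic// setIT.
rewrite Vg// setIC integral_mkcondr.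
apply: eq_integral => x _; rewrite patchE indicE.
by case: ifPn => _; rewrite ?mul1r ?mul0r.
Qed.

Let integral_nnsfun_density (h : {nnsfun R >-> R}) :
  \int[P]_t (h (V t))%:E = \int[leb]_(x in D) (h x * g x)%:E.
Proof.
have mI r : measurable_fun setT (\1_(h @^-1` [set r]) : R -> R).
  by apply: measurable_indic; exact: measurable_sfunP.
under [LHS]eq_integral do rewrite fimfunE -fsumEFin//.
rewrite [LHS]ge0_integral_fsum//; last 2 first.
- move=> r; apply/measurable_EFinP; apply: measurable_funM => //.
  exact: measurableT_comp.
- by move=> n x _; rewrite EFinM nnfun_muleindic_ge0.
transitivity (\int[leb]_(x in D)
    (\sum_(r \in range h) (r * \1_(h @^-1` [set r]) x * g x)%:E)); last first.
  apply: eq_integral => x _; rewrite EFinM fimfunE -fsumEFin//.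
  rewrite muleC ge0_mule_fsumr.
    by apply: eq_fsbigr => r _; rewrite -EFinM mulrC.
  by move=> r; rewrite EFinM nnfun_muleindic_ge0.
rewrite [RHS]ge0_integral_fsum//; last 2 first.
- move=> r; apply/measurable_EFinP; apply: measurable_funM => //.
  by apply: measurable_funM => //; apply: measurable_funTS; exact: mI.
- move=> r x Dx; rewrite EFinM mule_ge0//; last by rewrite lee_fin g0.
  by rewrite EFinM nnfun_muleindic_ge0.
apply: eq_fsbigr => r _.
have [r0|r0] := leP 0%R r; last first.
  rewrite preimage_nnfun0// !indic0.
  by rewrite !integral0_eq// => x _; rewrite mulr0 ?mul0r.
under eq_integral do rewrite EFinM; under [RHS]eq_integral do rewrite -mulrA EFinM.
rewrite !ge0_integralZl_EFin//.
- by rewrite integral_indic_density.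
- by move=> x Dx; rewrite lee_fin mulr_ge0 ?g0.
- apply/measurable_EFinP; apply: measurable_funM => //.
  by apply: measurable_funTS; exact: mI.
- by apply/measurable_EFinP; apply: measurableT_comp => //; exact: mI.
Qed.

Lemma ge0_integral_density (phi : R -> R) :
  measurable_fun setT phi -> (forall x, (0 <= phi x)%R) ->
  \int[P]_t (phi (V t))%:E = \int[leb]_(x in D) (phi x * g x)%:E.
Proof.
move=> mphi phi0; have mEphi : measurable_fun setT (EFin \o phi) by exact/measurable_EFinP.
pose f_ := nnsfun_approx measurableT mEphi.
have f_cvg x : (f_ n x)%:E @[n --> \oo] --> (phi x)%:E.
  by apply: (cvg_nnsfun_approx measurableT mEphi) => // y _; rewrite lee_fin.
have f_nd x : nondecreasing_seq (fun n => f_ n x).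
  by move=> m n mn; exact/lefP/nd_nnsfun_approx.
transitivity (limn (fun n => \int[P]_t (f_ n (V t))%:E)).
  rewrite -monotone_convergence//=.
  - by apply: eq_integral => t _; apply/esym/cvg_lim.
  - by move=> n; apply/measurable_EFinP; exact: measurableT_comp.
  - by move=> n t _; rewrite lee_fin.
  - by move=> t _ m n mn; rewrite lee_fin f_nd.
transitivity (limn (fun n => \int[leb]_(x in D) (f_ n x * g x)%:E)).
  by congr (limn _); apply/funext => n; exact: integral_nnsfun_density.
rewrite -monotone_convergence//=.
- apply: eq_integral => x /[!inE] Dx; apply/cvg_lim => //.
  by under eq_fun do rewrite EFinM; rewrite EFinM; apply: cvgeZr.
- move=> n; apply/measurable_EFinP; apply: measurable_funM => //.
  by apply: measurable_funTS; exact: (measurable_funPT (f_ n)).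
- by move=> n x Dx; rewrite lee_fin mulr_ge0 ?g0.
- by move=> x Dx m n mn; rewrite lee_fin ler_wpM2r ?g0 ?f_nd.
Qed.

End density.

Section normal_mgf.
Context {R : realType}.
Notation leb := (@lebesgue_measure R).

(** Completing the square: tilting a centred normal density by exp (c v) gives, up to the constant,
    the normal density with mean c s^2. *)
Lemma integral_expR_normal_pdf (s c : R) : s != 0 ->
  (\int[leb]_v (expR (c * v) * normal_pdf 0 s v)%:E = (expR (c ^+ 2 * s ^+ 2 / 2))%:E)%E.
Proof.
move=> s0.
transitivity (\int[leb]_v ((expR (c ^+ 2 * s ^+ 2 / 2))%:E * (normal_pdf (c * s ^+ 2) s v)%:E))%E.
  apply: eq_integral => v _; rewrite -EFinM; congr EFin.
  rewrite !normal_pdfE// !(mulrCA _ (normal_peak s)) /normal_fun -!expRD.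
  congr (_ * expR _); rewrite subr0 !mulr2n; field.
  by rewrite -mulr2n mulrn_eq0/= expf_eq0.
rewrite ge0_integralZl_EFin//; first by rewrite integral_normal_pdf mule1.
- by move=> v _; rewrite lee_fin normal_pdf_ge0.
- by apply/measurable_EFinP; exact: measurable_normal_pdf.
Qed.

End normal_mgf.

(** * Stopping at the first grid point below a level *)

Section first_hit.
Context {R : realType}.
Implicit Types (eps : R) (y : nat -> R) (k j : nat).

(* The time 0 is not tested, as in the definition of the first passage time. *)
Fixpoint hit eps y k : bool :=
  if k is k'.+1 then hit eps y k' || (y k <= eps) else false.

(** The stopping index cut off at the horizon k. A first hit at k and no hit at all give the same
    index, hence the separate predicate [hit]. *)
Fixpoint hit_index eps y k : nat :=
  if k is k'.+1 then if hit eps y k' then hit_index eps y k' else k else 0.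

Lemma hit_index_le eps y k : (hit_index eps y k <= k)%N.
Proof. by elim: k => //= k ih; case: ifP => // _; exact: leqW. Qed.

Lemma hit_indexN eps y k : ~~ hit eps y k -> hit_index eps y k = k.
Proof. by case: k => //= k; rewrite negb_or => /andP[/negbTE ->]. Qed.

Lemma hitN_gt eps y k j : ~~ hit eps y k -> (0 < j <= k)%N -> eps < y j.
Proof.
elim: k => [|k ih] /=; first by case: j.
rewrite negb_or -ltNge => /andP[hk yk] /andP[j0].
by rewrite leq_eqVlt ltnS => /predU1P[->//|jk]; apply: ih => //; rewrite j0.
Qed.

Lemma hit_le eps y k : hit eps y k ->
  (0 < hit_index eps y k)%N && (y (hit_index eps y k) <= eps).
Proof.
elim: k => //= k ih /orP[hk|yk]; first by rewrite hk; exact: ih.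
by case: ifPn => [/ih|].
Qed.

Lemma hit_index_gt eps y k j : (0 < j < hit_index eps y k)%N -> eps < y j.
Proof.
elim: k => [|k ih] /=; first by rewrite ltn0 andbF.
by case: ifPn => // hk; rewrite ltnS; exact: hitN_gt.
Qed.

Lemma hit_index_le_of eps y k j : (0 < j <= k)%N -> y j <= eps ->
  hit eps y k && (hit_index eps y k <= j)%N.
Proof.
move=> jk yj; have hk : hit eps y k.
  by apply: contraT => hk; have := hitN_gt hk jk; rewrite ltNge yj.
rewrite hk leqNgt; apply/negP => jlt; have /andP[j0 _] := jk.
by have := @hit_index_gt eps y k j; rewrite j0 jlt => /(_ isT); rewrite ltNge yj.
Qed.

End first_hit.

Lemma measurable_fun_of_bool d (T : measurableType d) (R : realType) (c : bool -> R)
    (f : T -> bool) : measurable_fun setT f -> measurable_fun setT (fun t => c (f t)).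
Proof.
move=> mf; rewrite (_ : (fun t => _) = fun t => if f t then c true else c false).
  exact: measurable_fun_ifT.
by apply/funext => t; case: (f t).
Qed.

Section discrete_martingale.
Context d (T : measurableType d) (R : realType) (P : probability T R).

(** W 0 vanishes only almost surely; subtracting it makes the path start at X w for every w and
    depend on W through increments alone. *)
Definition grid_path (W : R -> {RV P >-> R}) (X : T -> R) (mu h : R) (i : nat) (w : T) : R :=
  X w + (W (i%:R * h) w - W 0 w) - mu * (i%:R * h).

(* The martingale expR (- l * Y_t - s * t), with Y_t = X + W_t - mu * t and
   s = l * mu + l ^ 2 / 2, at the i-th time of the grid of step h. *)
Definition grid_martingale (W : R -> {RV P >-> R}) (X : T -> R) (mu h l : R) (i : nat) (w : T) : R :=
  expR (- l * grid_path W X mu h i w - (l * mu + l ^+ 2 / 2) * (i%:R * h)).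

Definition stopped_martingale (W : R -> {RV P >-> R}) (X : T -> R) (mu h l eps : R) (k : nat)
    (w : T) : R :=
  grid_martingale W X mu h l (hit_index eps (grid_path W X mu h ^~ w) k) w.

Variables (W : R -> {RV P >-> R}) (X : T -> R) (mu h : R).
Hypotheses (mX : measurable_fun setT X) (h0 : 0 < h).
Hypothesis hW : brownian_motion P W.
Hypothesis hXW : forall (A : set R) (E : set T), measurable A ->
  <<s [set F | exists t (B : set R),
         [/\ 0 <= t, measurable B & F = W t @^-1` B]] >> E ->
  P (X @^-1` A `&` E) = (P (X @^-1` A) * P E)%E.

Let gt i : R := i%:R * h.

Let Delta i : T -> R := W (gt i.+1) \- W (gt i).

Let gt_ge0 i : 0 <= gt i. Proof. by rewrite mulr_ge0// ltW. Qed.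

Let gt_nd : nondecreasing_seq gt.
Proof. by move=> i j ij; rewrite ler_wpM2r ?ler_nat// ltW. Qed.

Let mDelta i : measurable_fun setT (Delta i).
Proof. by apply: measurable_funB; exact: measurable_funPT. Qed.

Let mpre (V : T -> R) B : measurable_fun setT V -> measurable B -> measurable (V @^-1` B).
Proof. by move=> mV mB; rewrite -[X in measurable X]setTI; exact: mV. Qed.

(** A pi-system generating the sigma-algebra of X and the first i increments, made of the events to
    which both independence hypotheses apply directly. *)
Let past i : set (set T) := [set E | exists A (B : nat -> set R),
  [/\ measurable A, forall j, measurable (B j) &
      E = X @^-1` A `&` \bigcap_(j < i) (Delta j @^-1` B j)]].

Let past_measurable i : past i `<=` measurable.
Proof.
move=> _ [A [B [mA mB ->]]]; apply: measurableI; first exact: mpre.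
by apply: bigcap_measurableType => j _; exact: mpre.
Qed.

Let past_setI i : setI_closed (past i).
Proof.
move=> _ _ [A [B [mA mB ->]]] [A' [B' [mA' mB' ->]]].
exists (A `&` A'), (fun j => B j `&` B' j); split.
- exact: measurableI.
- by move=> j; exact: measurableI.
- rewrite setIACA preimage_setI -bigcapI; congr (_ `&` _).
Qed.

Let P_past i A (B : nat -> set R) : measurable A -> (forall j, measurable (B j)) ->
  P (X @^-1` A `&` \bigcap_(j < i) (Delta j @^-1` B j)) =
  (P (X @^-1` A) * \prod_(j < i) P (Delta j @^-1` B j))%E.
Proof.
move=> mA mB; rewrite hXW//.
  congr (_ * _)%E; have [_ inc _ _] := hW; apply: inc => //.
set GW := [set F | _].
pose TW : measurableType _ := g_sigma_algebraType GW.
have mW i' : measurable_fun setT (W (gt i') : TW -> R).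
  move=> _ C mC; rewrite setTI; apply: sub_sigma_algebra.
  by exists (gt i'), C.
have mD j : measurable_fun setT (Delta j : TW -> R) by exact: measurable_funB.
suff : measurable (\bigcap_(j < i) (Delta j @^-1` B j) : set TW) by [].
apply: bigcap_measurableType => j _.
by rewrite -[X in measurable X]setTI; exact: mD.
Qed.

Let past_Delta i E B : past i E -> measurable B ->
  P (E `&` Delta i @^-1` B) = (P E * P (Delta i @^-1` B))%E.
Proof.
move=> [A [C [mA mC ->]]] mB.
(* Putting [B] at index i turns the event into a rectangle over i + 1 increments, so [P_past]
   computes both sides. *)
pose C' j := if (j < i)%N then C j else B.
have mC' j : measurable (C' j) by rewrite /C'; case: ifP.
have -> : X @^-1` A `&` \bigcap_(j < i) (Delta j @^-1` C j) `&` Delta i @^-1` B =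
    X @^-1` A `&` \bigcap_(j < i.+1) (Delta j @^-1` C' j).
  rewrite -setIA; congr (_ `&` _); apply/seteqP; split => w.
  - move=> [Cw Bw] j /=; rewrite ltnS leq_eqVlt /C' => /predU1P[->|ji].
      by rewrite ltnn.
    by rewrite ji; exact: Cw.
  - move=> Cw; split.
      by move=> j /= ji; have := Cw j (ltnW ji); rewrite /C' /preimage/= ji.
    by have := Cw i (ltnSn i); rewrite /C' /preimage/= ltnn.
rewrite !P_past// big_ord_recr/= /C' ltnn muleA; congr (_ * _ * _)%E.
by apply: eq_bigr => j _; rewrite ltn_ord.
Qed.

Let integral_Delta l i : (\int[P]_w (expR (- l * Delta i w))%:E = (expR (l ^+ 2 * h / 2))%:E)%E.
Proof.
pose Vm := isMeasurableFun.Build _ _ _ _ _ (mDelta i).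
pose V : {RV P >-> R} := HB.pack (Delta i) Vm.
have gti : gt i.+1 - gt i = h by rewrite /gt -natr1; ring.
have s0 : Num.sqrt (gt i.+1 - gt i) != 0 by rewrite gti gt_eqF// sqrtr_gt0.
transitivity (\int[@lebesgue_measure R]_(v in setT)
    (expR (- l * v) * normal_pdf 0 (Num.sqrt (gt i.+1 - gt i)) v)%:E)%E.
  apply: (@ge0_integral_density _ _ _ P V setT
    (normal_pdf 0 (Num.sqrt (gt i.+1 - gt i))) measurableT _ _ _ (fun v => expR (- l * v))).
  - exact: measurable_normal_pdf.
  - by move=> x _; exact: normal_pdf_ge0.
  - move=> A mA; rewrite setIT; have [_ _ norm _] := hW; apply: norm => //.
    by rewrite -subr_gt0 gti.
  - by apply: measurableT_comp => //; exact: measurable_funM.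
  - by move=> v; exact: expR_ge0.
by rewrite integral_expR_normal_pdf// sqrrN sqr_sqrtr gti// ltW.
Qed.

Let TG i : measurableType _ := g_sigma_algebraType (past i).

Let mX_past i : measurable_fun setT (X : TG i -> R).
Proof.
move=> _ B mB; rewrite setTI; apply: sub_sigma_algebra.
exists B, (fun=> setT); split => //; rewrite (_ : bigcap _ _ = setT) ?setIT//.
by apply/seteqP; split => // w _ j _.
Qed.

Let mDelta_past i j : (j < i)%N -> measurable_fun setT (Delta j : TG i -> R).
Proof.
move=> ji _ B mB; rewrite setTI; apply: sub_sigma_algebra.
exists setT, (fun k => if k == j then B else setT); split => //.
  by move=> k; case: ifP.
rewrite preimage_setT setTI; apply/seteqP; split => [w Bw k _|w].
  by rewrite /preimage/=; case: ifPn => // /eqP ->.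
by move=> /(_ j ji); rewrite /preimage/= eqxx.
Qed.

Let Y := grid_path W X mu h.
Let Z l := grid_martingale W X mu h l.

Let Delta_sum k w : W (gt k) w - W 0 w = \sum_(j < k) Delta j w.
Proof.
elim: k => [|k ih]; first by rewrite big_ord0 /gt mul0r subrr.
by rewrite big_ord_recr -ih /Delta/=; ring.
Qed.

Let mY_past i k : (k <= i)%N -> measurable_fun setT (Y k : TG i -> R).
Proof.
move=> ki; rewrite /Y /grid_path -/(gt k); apply: measurable_funB => //.
apply: measurable_funD; first exact: mX_past.
under eq_fun do rewrite Delta_sum.
by apply: measurable_sum => j; apply: mDelta_past; exact: leq_trans ki.
Qed.

Let mhit_past eps i k : (k <= i)%N ->
  measurable_fun setT (fun w : TG i => hit eps (Y ^~ w) k).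
Proof.
elim: k => [|k ih] ki /=; first exact: measurable_cst.
apply: measurable_or; first by apply: ih; exact: ltnW.
by apply: measurable_fun_ler => //; exact: mY_past.
Qed.

Let mY k : measurable_fun setT (Y k : T -> R).
Proof.
apply: measurable_funB => //; apply: measurable_funD => //.
by apply: measurable_funB; exact: measurable_funPT.
Qed.

Let mZ l k : measurable_fun setT (Z l k : T -> R).
Proof.
apply: measurableT_comp => //; apply: measurable_funB => //.
by apply: measurable_funM => //; exact: mY.
Qed.

Let mhit eps k : measurable_fun setT (fun w : T => hit eps (Y ^~ w) k).
Proof.
elim: k => [|k ih] /=; first exact: measurable_cst.
by apply: measurable_or => //; apply: measurable_fun_ler => //; exact: mY.
Qed.

Lemma measurable_stopped_martingale l eps k :
  measurable_fun setT (stopped_martingale W X mu h l eps k).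
Proof.
rewrite /stopped_martingale -/Y -/(Z l); elim: k => [|k ih] /=; first exact: mZ.
rewrite (_ : (fun w => _) = fun w => if hit eps (Y ^~ w) k
    then Z l (hit_index eps (Y ^~ w) k) w else Z l k.+1 w); last first.
  by apply/funext => w; case: ifP.
apply: measurable_fun_ifT => //.
Qed.

(** The part l mu of s cancels the drift, and the part l^2 / 2 normalises exp (- l Delta) to mean
    1. *)
Let ZS l i w : Z l i.+1 w = Z l i w * (expR (- l * Delta i w) * expR (- (l ^+ 2 * h / 2))).
Proof.
rewrite /Z /grid_martingale -!expRD; congr expR.
by rewrite /Y /grid_path /Delta /gt -natr1 /=; field.
Qed.

(** Having missed the level up to k is an event of the past, as is Z at k, while the next factor is
    independent of the past with mean 1. *)
Let Z_step l eps k :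
  (\int[P]_w ((~~ hit eps (Y ^~ w) k)%:R * Z l k.+1 w)%:E =
   \int[P]_w ((~~ hit eps (Y ^~ w) k)%:R * Z l k w)%:E)%E.
Proof.
pose Vm := isMeasurableFun.Build _ _ _ _ _ (mDelta k).
pose V : {RV P >-> R} := HB.pack (Delta k) Vm.
pose U (w : TG k) := ((~~ hit eps (Y ^~ w) k)%:R * Z l k w)%:E.
pose f (v : R) := (expR (- l * v) * expR (- (l ^+ 2 * h / 2)))%:E.
have mU : measurable_fun setT U.
  apply/measurable_EFinP; apply: measurable_funM.
    apply: (@measurable_fun_of_bool _ _ _ (fun b : bool => (~~ b)%:R)).
    exact: mhit_past.
  apply: measurableT_comp => //; apply: measurable_funB => //.
  by apply: measurable_funM => //; exact: mY_past.
have mf : measurable_fun setT f.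
  apply/measurable_EFinP; apply: measurable_funM => //.
  by apply: measurableT_comp => //; exact: measurable_funM.
transitivity (\int[P]_w (U w * f (V w)))%E.
  by apply: eq_integral => w _; rewrite ZS mulrA EFinM.
rewrite (ge0_integral_indep_sigma_algebra (@past_setI k) (@past_measurable k) _ mU mf)//.
- rewrite [X in (_ * X)%E](_ : _ = 1%E) ?mule1//.
  under eq_integral do rewrite /f EFinM.
  rewrite ge0_integralZr//=; first by rewrite integral_Delta -EFinM -expRD subrr expR0.
  + apply/measurable_EFinP; apply: measurableT_comp => //.
    by apply: measurable_funM => //; exact: mDelta.
- by move=> E B; exact: past_Delta.
- by move=> w; rewrite lee_fin mulr_ge0 ?expR_ge0.
- by move=> v; rewrite lee_fin mulr_ge0 ?expR_ge0.
Qed.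

(** From k to k + 1 the stopped process changes only where there was no hit up to k, and [Z_step]
    shows that this part keeps its mean. *)
Lemma integral_stopped_martingale l eps k :
  (\int[P]_w (stopped_martingale W X mu h l eps k w)%:E =
   \int[P]_w (expR (- l * X w))%:E)%E.
Proof.
pose S k w := stopped_martingale W X mu h l eps k w.
have S0 i w : 0 <= S i w by exact: expR_ge0.
have Z0 i w : 0 <= Z l i w by exact: expR_ge0.
pose hN i w : R := (~~ hit eps (Y ^~ w) i)%:R.
pose hh i w : R := (hit eps (Y ^~ w) i)%:R.
have mhh i : measurable_fun setT (hh i).
  by apply: (@measurable_fun_of_bool _ _ _ (fun b : bool => b%:R)); exact: mhit.
have mhN i : measurable_fun setT (hN i).
  by apply: (@measurable_fun_of_bool _ _ _ (fun b : bool => (~~ b)%:R)); exact: mhit.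
have mS i : measurable_fun setT (S i) by exact: measurable_stopped_martingale.
have splitD (A B : T -> R) i : measurable_fun setT A -> measurable_fun setT B ->
    (forall w, 0 <= A w) -> (forall w, 0 <= B w) ->
    (\int[P]_w (hh i w * A w + hN i w * B w)%:E =
     \int[P]_w (hh i w * A w)%:E + \int[P]_w (hN i w * B w)%:E)%E.
  move=> mA mB A0 B0; under eq_integral do rewrite EFinD.
  rewrite ge0_integralD//.
  - by move=> w _; rewrite lee_fin mulr_ge0.
  - by apply/measurable_EFinP; exact: measurable_funM.
  - by move=> w _; rewrite lee_fin mulr_ge0.
  - by apply/measurable_EFinP; exact: measurable_funM.
elim: k => [|k ih].
  apply: eq_integral => w _; congr (expR _)%:E.
  by rewrite /grid_path mul0r !mulr0 !subr0 subrr addr0.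
rewrite -ih; transitivity (\int[P]_w (hh k w * S k w + hN k w * Z l k.+1 w)%:E)%E.
  apply: eq_integral => w _; rewrite /stopped_martingale/= -/Y /hh /hN; congr EFin.
  by case: ifP => _; rewrite !(mul1r, mul0r, addr0, add0r).
rewrite splitD// Z_step -splitD//; apply: eq_integral => w _; congr EFin.
rewrite /hh /hN; case: (boolP (hit _ _ _)) => [_|hk].
  by rewrite mul1r mul0r addr0.
by rewrite mul0r mul1r add0r /stopped_martingale -/Y hit_indexN.
Qed.

End discrete_martingale.

(** * Passage to the limit in the mesh *)

Section pathwise.
Context {R : realType}.
Implicit Types (y : R -> R) (eps l s e : R) (N n : nat).

Definition path_passage y : \bar R := ereal_inf [set t%:E | t in [set t | 0 < t /\ y t <= 0]].

Definition grid_stop y N n eps : nat :=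
  hit_index eps (fun i => y (i%:R * n.+1%:R^-1)) (N * n.+1).

Definition path_exp y N n eps l s : R :=
  let t := (grid_stop y N n eps)%:R * n.+1%:R^-1 in expR (- l * y t - s * t).

Lemma path_passage_ge0 y : (0 <= path_passage y)%E.
Proof. by apply: le_ereal_inf_tmp => _ [t [t0 _] <-]; rewrite lee_fin ltW. Qed.

Lemma near_grid_lt e : 0 < e -> \forall n \near \oo, n.+1%:R^-1 < e :> R.
Proof. by move=> e0; exact: (near_infty_natSinv_lt (PosNum e0)). Qed.

(** Just after the passage time there is t with y t <= 0; by continuity y < eps near t, and a fine
    grid has a point there. So the grid stops at most slightly after the passage, at a value at most
    eps. *)
Lemma path_exp_ge y N eps l s e : continuous y -> 0 < eps -> 0 <= l -> 0 <= s -> 0 < e ->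
  (path_passage y < N%:R%:E)%E ->
  \forall n \near \oo,
    expR (- l * eps - s * fine (path_passage y) - e) <= path_exp y N n eps l s.
Proof.
move=> cy eps0 l0 s0 e0 tauN; set tau := path_passage y.
have tau_fin : tau \is a fin_num.
  by rewrite ge0_fin_numE ?path_passage_ge0// (lt_trans tauN)// ltry.
(* A delay of 2 eta costs at most e in the exponent, because s / (s + 1) <= 1; the added 1 allows s
   = 0. *)
pose eta := e / (2 * (s + 1)).
have s10 : 0 < s + 1 by rewrite ltr_wpDl.
have eta0 : 0 < eta by rewrite divr_gt0// mulr_gt0.
have : (tau < Order.min N%:R%:E (tau + eta%:E))%E.
  by rewrite lt_min tauN lteDl// lte_fin.
move=> /ereal_inf_lt[_ [t [t0 yt] <-]]; rewrite lt_min lte_fin => /andP[tN].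
rewrite -[tau]fineK// -EFinD lte_fin => t_lt.
have [r r0 yr] : exists2 r, 0 < r & forall t', `|t - t'| < r -> y t' < eps.
  have /cvgr_lt/(_ eps) := cy t => /(_ (le_lt_trans yt eps0)).
  by move=> /nbhs_ballP[r r0 h]; exists r => // t' tt'; exact: h.
near=> n; rewrite /path_exp /grid_stop.
have hr : n.+1%:R^-1 < r by near: n; exact: near_grid_lt.
have hN : n.+1%:R^-1 < N%:R - t by near: n; apply: near_grid_lt; rewrite subr_gt0.
have heta : n.+1%:R^-1 < eta by near: n; exact: near_grid_lt.
move: hr hN heta; set h : R := n.+1%:R^-1 => hr hN heta.
have h0 : 0 < h by rewrite invr_gt0.
(* The first grid index strictly after t, hence positive and among the tested ones. *)
pose j := (Num.truncn (t * n.+1%:R)).+1.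
have nh : n.+1%:R * h = 1 by rewrite mulfV.
have tj : t < j%:R * h.
  rewrite -ltr_pdivrMr// /h invrK; exact: truncnS_gt.
have jt : j%:R * h <= t + h.
  rewrite -natr1 mulrDl mul1r lerD2r -ler_pdivlMr// /h invrK.
  by rewrite truncn_le// mulr_ge0// ltW.
have jM : (0 < j <= N * n.+1)%N.
  rewrite /= -(ler_nat R) -(ler_pM2r h0) natrM -mulrA nh mulr1; lra.
have yj : y (j%:R * h) <= eps by apply/ltW/yr; rewrite distrC ger0_norm; lra.
have := hit_index_le_of (y := fun i => y (i%:R * h)) jM yj.
set k := hit_index _ _ _ => /andP[hk kj].
have /andP[_ yk] := hit_le hk; rewrite -/k in yk.
have kh : k%:R * h <= t + h by apply: le_trans jt; rewrite ler_pM2r// ler_nat.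
rewrite ler_expR.
have h1 : - l * eps <= - l * y (k%:R * h) by rewrite !mulNr lerN2 ler_wpM2l.
have h2 : s * (k%:R * h) <= s * (fine tau + 2 * eta) by rewrite ler_wpM2l//; lra.
have h3 : s * (2 * eta) <= e.
  rewrite /eta (_ : s * (2 * (e / (2 * (s + 1)))) = s / (s + 1) * e); last first.
    by field; rewrite gt_eqF.
  by rewrite ler_piMl ?(ltW e0)// ler_pdivrMr// mul1r lerDl.
move: h2; rewrite mulrDr; lra.
Unshelve. all: by end_near. Qed.

Let close_within (t t' u h r : R) : `|t - t'| < r / 2 -> t' <= u -> u <= t' + h -> h < r / 2 ->
  - r < t - u < r.
Proof. by rewrite ltr_norml => /andP[? ?] ? ? ?; apply/andP; split; lra. Qed.

(** One-sided uniform continuity, by compactness of the interval. It bounds the drop of y during one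
    step of the grid, hence the overshoot. *)
Lemma path_uniform_lower y N e : continuous y -> 0 < e ->
  \forall n \near \oo, `[0, N%:R]%classic `<=`
    [set t | forall u, t <= u <= t + n.+1%:R^-1 -> y t - e <= y u].
Proof.
move=> cy e0.
suff key (t : R) : \forall t' \near t & n \near \oo,
    forall u, t' <= u <= t' + n.+1%:R^-1 -> y t' - e <= y u.
  have /compact_near_coveringP := @segment_compact R 0 N%:R.
  by apply => t _; exact: key.
have e20 : 0 < e / 2 by rewrite divr_gt0.
have /cvgrPdist_lt/(_ _ e20)/nbhs_ballP[r/= r0 yr] := cy t.
have r20 : 0 < r / 2 by rewrite divr_gt0.
exists (ball t (r / 2), [set n | n.+1%:R^-1 < r / 2]) => /=.
  by split; [exact: nbhsx_ballx|exact: near_grid_lt].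
move=> [t' n] /= [tt' hn] u /andP[t'u ut'].
have h1 : `|y t - y t'| < e / 2.
  by apply: yr; rewrite /ball/= (lt_trans tt')//; lra.
have h2 : `|y t - y u| < e / 2.
  have tt'2 : `|t - t'| < r / 2 by exact: tt'.
  apply: yr; change (`|t - u| < r); rewrite ltr_norml.
  exact: (close_within tt'2 t'u ut' hn).
move: h1 h2; rewrite !ltr_norml => /andP[? ?] /andP[? ?]; lra.
Qed.

(** A grid hit at level 0 is a genuine passage, so it does not precede the passage time, and the
    previous grid value is nonnegative, so the overshoot is small. Without a hit the path is
    positive at time N. *)
Lemma path_exp_le y N l s e : (0 < N)%N -> continuous y -> 0 <= y 0 -> 0 <= l -> 0 <= s -> 0 < e ->
  \forall n \near \oo, path_exp y N n 0 l s <=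
    expR (e - s * fine (Order.min (path_passage y) N%:R%:E)).
Proof.
move=> N0 cy y0 l0 s0 e0; set tau := path_passage y.
have l10 : 0 < l + 1 by rewrite ltr_wpDl.
(* An overshoot of e / (l + 1) adds at most e to the exponent, and l = 0 is allowed. *)
have el0 : 0 < e / (l + 1) by rewrite divr_gt0.
near=> n; rewrite /path_exp /grid_stop.
have : `[0, N%:R]%classic `<=`
    [set t | forall u, t <= u <= t + n.+1%:R^-1 -> y t - e / (l + 1) <= y u].
  by near: n; exact: path_uniform_lower.
set h : R := n.+1%:R^-1 => unif.
have h0 : 0 < h by rewrite invr_gt0.
have nh : n.+1%:R * h = 1 by rewrite mulfV.
set yh := (fun i => y _); set k := hit_index _ _ _.
have kM : (k <= N * n.+1)%N by exact: hit_index_le.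
have khN : k%:R * h <= N%:R.
  have -> : N%:R = (N * n.+1)%:R * h by rewrite natrM -mulrA nh mulr1.
  by rewrite ler_pM2r// ler_nat.
have min_fin : Order.min tau N%:R%:E \is a fin_num.
  rewrite ge0_fin_numE; first by rewrite gt_min ltry orbT.
  by rewrite le_min path_passage_ge0 lee_fin ler0n.
rewrite ler_expR; have [hk|hk] := boolP (hit 0 yh (N * n.+1)).
  have /andP[k0 yk] := hit_le hk; rewrite -/k in k0 yk.
  have tauk : fine (Order.min tau N%:R%:E) <= k%:R * h.
    rewrite -lee_fin fineK// ge_min; apply/orP; left.
    apply: ereal_inf_lbound; exists (k%:R * h) => //; split => //.
    by rewrite mulr_gt0// ltr0n.
  (* If the first hit is at index 1, the previous point is time 0, which is not tested; there the
     assumption on y 0 takes over. *)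
  have ykp : 0 <= y (k.-1%:R * h).
    have [k1|k1] := posnP k.-1; first by rewrite k1 mul0r.
    apply/ltW; apply: (@hit_index_gt _ 0 yh (N * n.+1)).
    by rewrite k1 -/k ltn_predL.
  have kp : k%:R * h = k.-1%:R * h + h by rewrite -[in LHS](prednK k0) -natr1 mulrDl mul1r.
  have := unif (k.-1%:R * h).
  rewrite /= in_itv/= mulr_ge0 ?(ltW h0)//= => /(_ _ (k%:R * h)).
  rewrite {1}kp lerDl (ltW h0) kp lexx => h1.
  have h2 : y (k.-1%:R * h) - e / (l + 1) <= y (k%:R * h).
    by rewrite kp; apply: h1 => //; rewrite (le_trans _ khN)// kp lerDl ltW.
  have h3 : s * fine (Order.min tau N%:R%:E) <= s * (k%:R * h) by rewrite ler_wpM2l.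
  have h4 : l * - y (k%:R * h) <= l * (e / (l + 1)) by rewrite ler_wpM2l//; lra.
  have h5 : l * (e / (l + 1)) <= e.
    rewrite mulrA -mulrAC -[X in X * e <= _]/(l / (l + 1)) ler_piMl ?(ltW e0)//.
    by rewrite ler_pdivrMr// mul1r lerDl.
  rewrite -kp mulNr -mulrN; lra.
have kE : k = (N * n.+1)%N by exact: hit_indexN.
have khE : k%:R * h = N%:R by rewrite kE natrM -mulrA nh mulr1.
have yN : 0 < y (k%:R * h).
  by have := @hitN_gt _ 0 yh (N * n.+1) k hk; rewrite kE muln_gt0 N0 leqnn => /(_ isT).
have h1 : fine (Order.min tau N%:R%:E) <= N%:R.
  by rewrite -lee_fin fineK// ge_min lexx orbT.
have h2 : s * fine (Order.min tau N%:R%:E) <= s * N%:R by rewrite ler_wpM2l.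
have h3 : 0 <= l * y (k%:R * h) by rewrite mulr_ge0// ltW.
move: h3; rewrite khE => h3; rewrite mulNr; lra.
Unshelve. all: by end_near. Qed.

End pathwise.

Section bounded_convergence.
Context d (T : measurableType d) (R : realType) (P : probability T R).

Lemma cvg_bounded_integral (F : nat -> T -> R) (G : T -> R) (K : R) :
  (forall n, measurable_fun setT (F n)) -> measurable_fun setT G ->
  {ae P, forall w, F ^~ w @ \oo --> G w} -> (forall n w, 0 <= F n w <= K) ->
  (\int[P]_w (F n w)%:E @[n --> \oo] --> \int[P]_w (G w)%:E)%E.
Proof.
move=> mF mG FG FK.
have iK : P.-integrable setT (EFin \o cst K).
  exact: finite_measure_integrable_cst.
have mEF n : measurable_fun setT (fun w => (F n w)%:E) by exact/measurable_EFinP.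
have mEG : measurable_fun setT (fun w => (G w)%:E) by exact/measurable_EFinP.
have FG' : {ae P, forall w, setT w -> (F n w)%:E @[n --> \oo] --> (G w)%:E}.
  by apply: filterS FG => w FGw _; apply: cvg_EFin => //; exact: nearW.
have FK' : {ae P, forall w n, setT w -> (`|(F n w)%:E| <= (EFin \o cst K) w)%E}.
  by apply: aeW => w n _; have /andP[F0 FK'] := FK n w; rewrite lee_fin ger0_norm.
by have [] := dominated_convergence measurableT mEF mEG FG' iK FK'.
Qed.

End bounded_convergence.

(** * The Laplace transform of the first passage time *)

Section passage_laplace.
Context d (T : measurableType d) (R : realType) (P : probability T R).
Variables (W : R -> {RV P >-> R}) (X : {RV P >-> R}) (mu : R).
Hypotheses (X0 : forall w, 0 <= X w) (hW : brownian_motion P W).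
Hypothesis hXW : independent_of_process P X W.

Variable tau : T -> \bar R.
Hypotheses (mtau : measurable_fun setT tau) (tau_ge0 : forall w, (0 <= tau w)%E).
Hypothesis tauE : {ae P, forall w, first_passage_time W X (fun t => mu * t) w = tau w}.
Hypothesis tau_fin : {ae P, forall w, tau w \is a fin_num}.

(** Continuity of W is known on nonnegative times only; [Num.max t 0] extends it, so that the path
    is continuous on the whole line. *)
Let path w (t : R) : R := X w + (W (Num.max t 0) w - W 0 w) - mu * t.

Let good w := [/\ W 0 w = 0, {within `[0, +oo[, continuous (fun t => W t w)} &
  first_passage_time W X (fun t => mu * t) w = tau w].

Let ae_good : {ae P, forall w, good w}.
Proof. by have [W0 _ _ cW] := hW; apply: filterS3 W0 cW tauE => w. Qed.

Let continuous_path w : good w -> continuous (path w).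
Proof.
move=> [_ cW _] t; apply: cvgB; last by apply: cvgMl_tmp; exact: cvg_id.
apply: cvgD; first exact: cvg_cst; apply: cvgB; last exact: cvg_cst.
have /subspace_continuousP/(_ (Num.max t 0)) := cW.
rewrite /= in_itv/= andbT le_max lexx orbT => /(_ isT) cWt.
apply: (cvg_comp (fun t => Num.max t 0) (fun t => W t w) _ cWt).
have cmax : Num.max u 0 @[u --> t] --> Num.max t 0.
  by apply: (@continuous_max _ _ id (cst 0)); [exact: cvg_id|exact: cvg_cst].
move=> A wA.
have h : nbhs t (fun u => `[0, +oo[%classic (Num.max u 0) -> A (Num.max u 0)).
  exact: cmax _ wA.
change (nbhs t (fun u => A (Num.max u 0))).
apply: filterS h => u; apply.
by rewrite /= in_itv/= andbT le_max lexx orbT.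
Qed.

Let path_passageE w : good w -> path_passage (path w) = tau w.
Proof.
move=> [W0 _ <-]; have pathE t : 0 < t -> path w t = X w + W t w - mu * t.
  by move=> t0; rewrite /path W0 subr0 max_l// ltW.
congr ereal_inf; apply/seteqP; split => _ [t [t0 ht] <-]; exists t => //; split => //.
  by move: ht; rewrite pathE//; lra.
by rewrite pathE//; lra.
Qed.

Let path0 w : 0 <= path w 0.
Proof. by rewrite /path max_l// subrr addr0 mulr0 subr0. Qed.

Let S N n l eps w := stopped_martingale W X mu n.+1%:R^-1 l eps (N * n.+1) w.

Let SE N n l eps w :
  S N n l eps w = path_exp (path w) N n eps l (l * mu + l ^+ 2 / 2).
Proof.
have pathE i : grid_path W X mu n.+1%:R^-1 i w = path w (i%:R * n.+1%:R^-1).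
  by rewrite /grid_path /path max_l// mulr_ge0.
rewrite /S /stopped_martingale /grid_martingale /path_exp /grid_stop pathE.
by rewrite (_ : grid_path W X mu n.+1%:R^-1 ^~ w = fun i => path w (i%:R * n.+1%:R^-1))//;
  apply/funext.
Qed.

Let hn n : 0 < n.+1%:R^-1 :> R. Proof. by rewrite invr_gt0. Qed.

Let mS N n l eps : measurable_fun setT (S N n l eps).
Proof. by apply: measurable_stopped_martingale; exact: measurable_funPT. Qed.

Let integral_S N n l eps :
  (\int[P]_w (S N n l eps w)%:E = \int[P]_w (expR (- l * X w))%:E)%E.
Proof.
apply: (integral_stopped_martingale mu _ (hn n) hW hXW).
exact: measurable_funPT.
Qed.

Let S_ge0 N n l eps w : 0 <= S N n l eps w. Proof. exact: expR_ge0. Qed.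

Let V w := fine (tau w).

Let mV : measurable_fun setT V.
Proof. exact: measurableT_comp mtau. Qed.

Let V_ge0 w : 0 <= V w. Proof. exact: fine_ge0. Qed.

Let mexpR (c : R) (Y : T -> R) : measurable_fun setT Y ->
  measurable_fun setT (fun w => expR (- c * Y w)).
Proof. by move=> mY; apply: measurableT_comp => //; exact: measurable_funM. Qed.

Let expRN_le1 (c x : R) : 0 <= c -> 0 <= x -> expR (- c * x) <= 1.
Proof. by move=> c0 x0; rewrite expR_le1 mulNr oppr_le0 mulr_ge0. Qed.

Section fixed_exponent.
Variable l : R.
Hypothesis l_ge0 : 0 <= l.
Hypothesis mu_ge0 : 0 <= mu.

Let s := l * mu + l ^+ 2 / 2.

Let s_ge0 : 0 <= s.
Proof. by rewrite addr_ge0 ?mulr_ge0// sqr_ge0. Qed.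

(** The single parameter N is the horizon and also sets the stopping level 1 / (N + 1), so one limit
    removes both. *)
Let lower N w : R := (tau w < N%:R%:E)%E%:R * expR (- l * N.+1%:R^-1) * expR (- s * V w).

Let measurable_lower N : measurable_fun setT (lower N).
Proof.
apply: measurable_funM; last exact: mexpR.
apply: measurable_funM => //.
apply: (@measurable_fun_of_bool _ _ _ (fun b : bool => b%:R)).
exact: measurable_fun_lte.
Qed.

Let lower01 N w : 0 <= lower N w <= 1.
Proof.
rewrite /lower mulr_ge0 ?mulr_ge0 ?expR_ge0//=.
rewrite mulr_ile1 ?mulr_ge0 ?expR_ge0 ?expRN_le1//.
by rewrite mulr_ile1 ?expR_ge0 ?expRN_le1 ?invr_ge0//; case: (_ < _)%E.
Qed.

(* Stopping at a positive level instead of 0 makes a fine grid detect the passage. *)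
Let integral_lower N :
  (\int[P]_w (lower N w)%:E <= \int[P]_w (expR (- l * X w))%:E)%E.
Proof.
(* Pathwise, S is only asymptotically bounded below. Its minimum with [lower N] is bounded,
   converges to [lower N], and stays below S. *)
pose F n w := Num.min (S N n l N.+1%:R^-1 w) (lower N w).
have F01 n w : 0 <= F n w <= 1.
  have /andP[h0 h1] := lower01 N w.
  by rewrite /F le_min S_ge0 h0/= ge_min h1 orbT.
have mF n : measurable_fun setT (F n) by exact: measurable_minr.
have cF : (\int[P]_w (F n w)%:E @[n --> \oo] --> \int[P]_w (lower N w)%:E)%E.
  apply: (cvg_bounded_integral mF (measurable_lower N) _ F01).
  apply: filterS ae_good => w gw.
  apply/cvgrPdist_le => e e0.
  have [tauN|tauN] := boolP (tau w < N%:R%:E)%E; last first.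
    apply: nearW => n; rewrite /F /lower (negbTE tauN) !mul0r min_r ?S_ge0//.
    by rewrite subrr normr0 ltW.
  have tauN' : (path_passage (path w) < N%:R%:E)%E by rewrite path_passageE.
  have := path_exp_ge (continuous_path gw) (hn N) l_ge0 s_ge0 e0 tauN'.
  apply: filterS => n; rewrite -SE path_passageE// => Sge.
  have /andP[L0 L1] := lower01 N w.
  have FL : F n w <= lower N w by rewrite /F ge_min lexx orbT.
  rewrite ger0_norm ?subr_ge0// lerBlDr -lerBlDl /F le_min; apply/andP; split; last first.
    by rewrite lerBlDr lerDl ltW.
  apply: le_trans Sge; rewrite expRD.
  have -> : expR (- l * N.+1%:R^-1 - s * fine (tau w)) = lower N w.
    by rewrite /lower tauN mul1r -expRD /V; congr expR; ring.
  have : 1 - e <= expR (- e) by have := expR_ge1Dx (- e).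
  nra.
apply: (cvge_le _ cF); apply: nearW => n.
rewrite -(integral_S N n l N.+1%:R^-1); apply: ge0_le_integral => //.
- by move=> w _; rewrite lee_fin; have /andP[] := F01 n w.
- by apply/measurable_EFinP; exact: mF.
- by apply/measurable_EFinP; exact: mS.
- by move=> w _; rewrite lee_fin /F ge_min lexx.
Qed.

Let upper N w : R := expR (- s * fine (Order.min (tau w) N%:R%:E)).

Let measurable_upper N : measurable_fun setT (upper N).
Proof. by apply: mexpR; apply: measurableT_comp => //; exact: measurable_mine. Qed.

Let upper01 N w : 0 <= upper N w <= 1.
Proof.
rewrite expR_ge0 expRN_le1// fine_ge0// le_min tau_ge0 lee_fin; exact: ler0n.
Qed.

(** Writing s(l) = l mu + l^2 / 2, s(2 l) = 2 s(l) + l^2; hence squaring gives the martingale with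
    exponent 2 l times exp (l^2 t), and the stopping time t is at most N. *)
Let sqr_S N n w :
  S N n l 0 w ^+ 2 <= expR (l ^+ 2 * N%:R) * S N n (2 * l) 0 w.
Proof.
rewrite /S /stopped_martingale /grid_martingale; set k := hit_index _ _ _.
have kN : k%:R * n.+1%:R^-1 <= N%:R :> R.
  by rewrite ler_pdivrMr// -natrM ler_nat hit_index_le.
rewrite -expRM_natl -expRD ler_expR.
have : l ^+ 2 * (k%:R * n.+1%:R^-1) <= l ^+ 2 * N%:R by rewrite ler_wpM2l// sqr_ge0.
move: (grid_path _ _ _ _ _ _) (k%:R * _) => y t; lra.
Qed.

(* The martingale with exponent 2 l bounds the second moment uniformly in the mesh, which
   gives uniform integrability. *)
Let integral_S_truncated N n K : 0 < K ->
  (\int[P]_w (expR (- l * X w))%:E <=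
   \int[P]_w (Num.min (S N n l 0 w) K)%:E + (expR (l ^+ 2 * N%:R) / K)%:E)%E.
Proof.
move=> K0; rewrite -(integral_S N n l 0).
have mmin : measurable_fun setT (fun w => Num.min (S N n l 0 w) K).
  exact: measurable_minr.
have l20 : 0 <= 2 * l by rewrite mulr_ge0.
apply: (@le_trans _ _ (\int[P]_w ((Num.min (S N n l 0 w) K)%:E +
    (expR (l ^+ 2 * N%:R) / K)%:E * (S N n (2 * l) 0 w)%:E))%E).
  apply: ge0_le_integral => //.
  - by move=> w _; rewrite lee_fin S_ge0.
  - by apply/measurable_EFinP; exact: mS.
  - apply/measurable_EFinP; apply: measurable_funD => //; apply: measurable_funM => //.
  - move=> w _; rewrite -EFinM -EFinD lee_fin.
    have [SK|KS] := leP (S N n l 0 w) K.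
      by rewrite lerDl mulr_ge0 ?S_ge0// divr_ge0 ?expR_ge0// ltW.
    (* Where S exceeds K, S <= S^2 / K. *)
    apply: (@le_trans _ _ (S N n l 0 w ^+ 2 / K)).
      by rewrite ler_pdivlMr// expr2 ler_pM2l ?ltW// (lt_trans K0).
    have := sqr_S N n w; rewrite -(ler_pM2r (x := K^-1)) ?invr_gt0//.
    rewrite [_ / K * _]mulrAC; lra.
rewrite ge0_integralD//; first last.
- by apply/measurable_EFinP; apply: measurable_funM => //; exact: mS.
- by move=> w _; rewrite -EFinM lee_fin mulr_ge0 ?S_ge0// divr_ge0 ?expR_ge0// ltW.
- by apply/measurable_EFinP.
- by move=> w _; rewrite lee_fin le_min S_ge0 ltW.
rewrite leeD2l// ge0_integralZl_EFin//; last 3 first.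
- by move=> w _; rewrite lee_fin S_ge0.
- by apply/measurable_EFinP; exact: mS.
- by rewrite divr_ge0 ?expR_ge0// ltW.
(* Optional stopping with exponent 2 l leaves E exp (- 2 l X), at most 1 because X >= 0. *)
rewrite integral_S -[leRHS]mule1; apply: lee_wpmul2l.
  by rewrite lee_fin divr_ge0 ?expR_ge0// ltW.
rewrite -(@probability_setT _ _ _ P) -[leRHS]mul1e -integral_cst//.
apply: ge0_le_integral => //.
- by apply/measurable_EFinP; exact: mexpR.
- by move=> w _; rewrite lee_fin expRN_le1.
Qed.

Let integral_upper N : (0 < N)%N ->
  (\int[P]_w (expR (- l * X w))%:E <= \int[P]_w (upper N w)%:E)%E.
Proof.
move=> N0; apply/lee_addgt0Pr => e e0.
(* This K makes the truncation error B / K at most e, and K >= 1 keeps the cut-off above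
   [upper N]. *)
pose B := expR (l ^+ 2 * N%:R); pose K := 1 + B / e.
have B0 : 0 < B by exact: expR_gt0.
have K1 : 1 <= K by rewrite lerDl divr_ge0// ltW.
have K0 : 0 < K by rewrite (lt_le_trans _ K1).
have BK : B / K <= e.
  by rewrite ler_pdivrMr// /K mulrDr mulr1 mulrC divfK ?gt_eqF// lerDr ltW.
(* The cut-off bounds F, and the maximum turns the asymptotic upper bound on S into convergence to
   [upper N]. *)
pose F n w := Num.max (Num.min (S N n l 0 w) K) (upper N w).
have F01 n w : 0 <= F n w <= K.
  have /andP[h0 h1] := upper01 N w.
  by rewrite /F le_max h0 orbT/= ge_max ge_min lexx orbT (le_trans h1).
have mmin n : measurable_fun setT (fun w => Num.min (S N n l 0 w) K).
  exact: measurable_minr.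
have mF n : measurable_fun setT (F n) by exact: measurable_maxr.
have cF : (\int[P]_w (F n w)%:E @[n --> \oo] --> \int[P]_w (upper N w)%:E)%E.
  apply: (cvg_bounded_integral mF (measurable_upper N) _ F01).
  apply: filterS ae_good => w gw; apply/cvgrPdist_le => r r0.
  (* An error ln (1 + r) in the exponent is a factor 1 + r, hence an excess of at most r over
     [upper N w] <= 1. *)
  have ln0 : 0 < ln (1 + r) by rewrite ln_gt0// ltrDl.
  have := path_exp_le N0 (continuous_path gw) (path0 w) l_ge0 s_ge0 ln0.
  apply: filterS => n; rewrite -SE path_passageE// => Sle.
  have /andP[U0 U1] := upper01 N w.
  have UF : upper N w <= F n w by rewrite /F le_max lexx orbT.
  rewrite distrC ger0_norm ?subr_ge0// lerBlDl /F ge_max; apply/andP; split; last first.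
    by rewrite lerDl ltW.
  rewrite ge_min; apply/orP; left; apply: (le_trans Sle).
  rewrite expRD lnK ?posrE ?addr_gt0//.
  have -> : expR (- (s * fine (Order.min (tau w) N%:R%:E))) = upper N w.
    by rewrite /upper mulNr.
  nra.
have Fle n : (\int[P]_w (expR (- l * X w))%:E - (B / K)%:E <= \int[P]_w (F n w)%:E)%E.
  rewrite leeBlDr//; apply: le_trans (integral_S_truncated N n K0) _.
  rewrite leeD2r//; apply: ge0_le_integral => //.
  - by move=> w _; rewrite lee_fin le_min S_ge0 ltW.
  - by apply/measurable_EFinP.
  - by apply/measurable_EFinP; exact: mF.
  - by move=> w _; rewrite lee_fin /F le_max lexx.
have UK : (\int[P]_w (expR (- l * X w))%:E - (B / K)%:E <= \int[P]_w (upper N w)%:E)%E.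
  by apply: (cvge_ge _ cF); exact: nearW.
move: UK; rewrite leeBlDr// => /le_trans; apply.
by rewrite leeD2l// lee_fin.
Qed.

Lemma laplace_first_passage :
  (\int[P]_w (expR (- (l * X w)))%:E =
   \int[P]_w (expR (- ((l * mu + l ^+ 2 / 2) * fine (tau w))))%:E)%E.
Proof.
under eq_integral do rewrite -mulNr; under [RHS]eq_integral do rewrite -mulNr.
have mE : measurable_fun setT (fun w => expR (- s * V w)) by exact: mexpR.
apply/eqP; rewrite eq_le; apply/andP; split.
- have cU : (\int[P]_w (upper N.+1 w)%:E @[N --> \oo] -->
      \int[P]_w (expR (- s * V w))%:E)%E.
    apply: (@cvg_bounded_integral _ _ _ _ (fun N => upper N.+1) _ 1) => //.
    apply: filterS tau_fin => w tw; apply: cvg_near_cst.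
    near=> N; rewrite /upper /V min_l//.
    rewrite -[tau w]fineK// lee_fin ltW//.
    rewrite (lt_le_trans (truncnS_gt _))// ler_nat ltnS.
    by near: N; exact: nbhs_infty_ge.
  by apply: (cvge_ge _ cU); apply: nearW => N; exact: integral_upper.
- have cL : (\int[P]_w (lower N w)%:E @[N --> \oo] -->
      \int[P]_w (expR (- s * V w))%:E)%E.
    apply: (@cvg_bounded_integral _ _ _ _ lower _ 1) => //.
    apply: filterS tau_fin => w tw.
    apply: (@cvg_trans _ ((fun N => expR (- l * N.+1%:R^-1) * expR (- s * V w)) @ \oo)).
      apply: near_eq_cvg; near=> N; rewrite /lower.
      rewrite (_ : (tau w < N%:R%:E)%E = true) ?mul1r//.
      rewrite -[tau w]fineK// lte_fin (lt_le_trans (truncnS_gt _))// ler_nat.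
      by near: N; exact: nbhs_infty_ge.
    have c0 : - l * N.+1%:R^-1 @[N --> \oo] --> (0 : R).
      have c0 : - l * harmonic N @[N --> \oo] --> - l * 0.
        by apply: cvgMl_tmp; exact: cvg_harmonic.
      by rewrite mulr0 in c0.
    have c1 : expR (- l * N.+1%:R^-1) @[N --> \oo] --> (1 : R).
      have ce := @continuous_expR R 0; rewrite /continuous_at expR0 in ce.
      exact: (cvg_comp _ _ c0 ce).
    have : expR (- l * N.+1%:R^-1) * expR (- s * V w) @[N --> \oo] --> 1 * expR (- s * V w).
      exact: cvgMr_tmp.
    by rewrite mul1r.
  by apply: (cvge_le _ cL); apply: nearW => N; exact: integral_lower.
Unshelve. all: by end_near. Qed.

End fixed_exponent.

End passage_laplace.

(** * Almost sure equalities and the law of X *)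

Section almost_everywhere_sets.
Context d (T : measurableType d) (R : realType).
Variable m : {measure set T -> \bar R}.

Lemma le_measure_ae (A B : set T) : measurable A -> measurable B ->
  {ae m, forall w, A w -> B w} -> (m A <= m B)%E.
Proof.
move=> mA mB [N [mN N0 AB]].
apply: (@le_trans _ _ (m (B `|` N))).
  apply: le_measure; rewrite ?inE//; first exact: measurableU.
  move=> w Aw; have [Bw|nBw] := pselect (B w); first by left.
  by right; apply: AB => /= /(_ Aw).
by rewrite -[leRHS]adde0 -N0; exact: measureU2.
Qed.

Lemma eq_measure_ae (A B : set T) : measurable A -> measurable B ->
  {ae m, forall w, A w <-> B w} -> m A = m B.
Proof.
move=> mA mB AB; apply/eqP; rewrite eq_le; apply/andP; split.
  by apply: le_measure_ae => //; apply: filterS AB => w [].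
by apply: le_measure_ae => //; apply: filterS AB => w [].
Qed.

End almost_everywhere_sets.

Theorem theorem4p1 (d : measure_display) (T : measurableType d) (R : realType)
    (P : probability T R) (W : R -> {RV P >-> R}) (X : {RV P >-> R})
    (mu : R) (p a b : nat -> R) (f : R -> R)
    (hW : brownian_motion P W)
    (hX : {ae P, forall w, 0 <= X w})
    (hXW : independent_of_process P X W)
    (hmu : 0 < mu)
    (hf : gamma_mixture mu p a b f)
    (htau : has_density P (first_passage_time W X (fun t => mu * t)) f) :
  (forall x, 0 < x ->
     cvgn (series (fun n => p n * matching_term mu (a n) (b n) x))) /\
  has_density P (EFin \o X)
    (fun x => limn (series (fun n => p n * matching_term mu (a n) (b n) x))).
Proof.
split=> [x x0|].
  by apply/cvg_ex; eexists; exact: cvg_matching_density hmu hf x x0.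
rewrite -/(matching_density mu p a b).
set g := matching_density mu p a b.
have mg : measurable_fun (`]0, +oo[%classic : set R) g.
  exact: measurable_matching_density hmu hf.
have g0 x : 0 < x -> 0 <= g x by exact: matching_density_ge0 hmu hf x.
pose tau := first_passage_time W X (fun t => mu * t).
have [mtau mf f0 f1 tauf] := htau.
have tau_ge0 w : (0 <= tau w)%E.
  by apply: le_ereal_inf_tmp => _ [t [t0 _] <-]; rewrite lee_fin ltW.
have tau_fin : {ae P, forall w, tau w \is a fin_num}.
  (* The density of the passage time has total mass 1 on finite times, so the boundary is almost
     surely reached. *)
  have fin1 : P (tau @^-1` (EFin @` setT)) = 1%E by rewrite tauf// setTI.
  have mfin : measurable (tau @^-1` (EFin @` setT)).
    by rewrite -[X in measurable X]setTI; apply: mtau => //; apply: measurable_image_EFin; exact: measurableT.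
  exists (~` (tau @^-1` (EFin @` setT))); split.
  - exact: measurableC.
  - by rewrite probability_setC// fin1 subee.
  - by apply: subsetC => w [r _ /= <-].
(* X is nonnegative only almost surely, while the pathwise estimates start from a nonnegative value
   at every point. The absolute value of X has the same law, is still independent of W, and almost
   surely has the same passage time. *)
have mXabs : measurable_fun setT (Num.norm \o X : T -> R).
  by apply: measurableT_comp.
pose Xm := isMeasurableFun.Build _ _ _ _ _ mXabs.
pose Xabs : {RV P >-> R} := HB.pack (Num.norm \o X : T -> R) Xm.
have XabsE w : Xabs w = `|X w| by [].
have mpre (Y : {RV P >-> R}) A : measurable A -> measurable (Y @^-1` A).
  by move=> mA; rewrite -[X in measurable X]setTI; exact: measurable_funPT.
have mabs (A : set R) : measurable A -> measurable (Num.norm @^-1` A : set R).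
  move=> mA; rewrite -[X in measurable X]setTI.
  exact: (@normr_measurable R setT).
have PXE A : measurable A -> P (X @^-1` A) = P (Xabs @^-1` A).
  move=> mA; apply: eq_measure_ae; [exact: mpre|exact: mpre|].
  by apply: filterS hX => w X0; rewrite /preimage/= ger0_norm.
have indep : independent_of_process P Xabs W.
  by move=> A E mA; exact: (hXW (Num.norm @^-1` A) E (mabs A mA)).
have fptE : {ae P, forall w, first_passage_time W Xabs (fun t => mu * t) w = tau w}.
  apply: filterS hX => w X0; rewrite /tau /first_passage_time XabsE ger0_norm//.
have mV : measurable_fun setT (fine \o tau : T -> R) by exact: measurableT_comp.
pose Vm := isMeasurableFun.Build _ _ _ _ _ mV.
pose V : {RV P >-> R} := HB.pack (fine \o tau : T -> R) Vm.
(* [fine] sends an infinite passage time to 0, which changes the law only on a null event. *)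
have Vf A : measurable A ->
    P (V @^-1` A) = (\int[lebesgue_measure]_(x in A `&` `]0%R, +oo[) (f x)%:E)%E.
  move=> mA; rewrite -tauf//; apply: eq_measure_ae; first exact: mpre.
    rewrite -[X in measurable X]setTI; apply: mtau => //.
    exact: measurable_image_EFin.
  apply: filterS tau_fin => w tw; rewrite /preimage/=; split.
    by move=> AV; exists (fine (tau w)); rewrite ?fineK.
  by move=> [r Ar]; rewrite -[first_passage_time _ _ _ w]/(tau w) => <-.
have laplaceX l : 0 <= l -> (\int[P]_w (expR (- (l * Xabs w)))%:E =
    \int[lebesgue_measure]_(x in `]0%R, +oo[) (expR (- (l * x)) * g x)%:E)%E.
  have Xabs0 w : 0 <= Xabs w by exact: normr_ge0.
  move=> l0; have mu0 := ltW hmu.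
  rewrite (laplace_first_passage Xabs0 hW indep mtau tau_ge0 fptE tau_fin l0 mu0).
  rewrite (laplace_matching_density hmu hf l0).
  have mpos : measurable (`]0, +oo[%classic : set R) by [].
  have f0' x : (`]0, +oo[%classic : set R) x -> 0 <= f x.
    by rewrite /= in_itv/= andbT; exact: f0.
  apply: (ge0_integral_density mpos mf f0' Vf
    (phi := fun t => expR (- ((l * mu + l ^+ 2 / 2) * t)))) => [|x]; last exact: expR_ge0.
  by apply: measurableT_comp => //; apply: measurableT_comp => //; exact: mulrl_measurable.
have Xg A : measurable A ->
    P (X @^-1` A) = (\int[lebesgue_measure]_(x in A `&` `]0%R, +oo[) (g x)%:E)%E.
  move=> mA; rewrite PXE//; apply: laplace_transform_unique => //.
    by move=> w; exact: normr_ge0.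
  by move=> j; exact: (laplaceX j%:R (ler0n _ _)).
split => //.
- exact/measurable_EFinP.
- by have := Xg _ measurableT; rewrite preimage_setT probability_setT setTI.
- move=> A mA; rewrite -Xg//; congr (P _); apply/seteqP; split => w /=.
    by move=> [r Ar [<-]].
  by move=> AX; exists (X w).
Qed.
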